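(* Let $K=\mathbb{Q}(\rho)$, where $\rho$ is a root of $x^3-ax^2-(a+3)x-1$ with $a\equiv 3$ or $21\pmod{27}$, $a>12$ and $\frac{a^2+3a+9}{27}$ square-free. Put $g_1=1$, $g_2=\rho$, $g_3=\frac{1+\rho+\rho^2}{3}$ (these form an integral basis of $K$). Up to multiplication by totally positive units, the indecomposable integers in $K$ are $1$ and \begin{itemize} \item[(i)] $g_3$, \item[(ii)] $-g_1-(r+1)g_2+3g_3=-r\rho+\rho^2$ where $1\leq r\leq\frac{a}{3}$, \item[(iii)] $-(2v+1)g_1-(v(a+3)+2)g_2+3(v+1)g_3=-v-(v(a+2)+1)\rho+(v+1)\rho^2$ where $\frac{2a}{3}+1\leq v\leq a$, \item[(iv)] $-(2v+1)g_1-(v+1)(a+2)g_2+3(v+1)g_3=-v-(v(a+2)+a-v+1)\rho+(v+1)\rho^2$ where $0\leq v\leq \frac{a}{3}-1$, \item[(v)] $-(2v+1)g_1-(v(a+3)+r+1)g_2+(3v+2)g_3$ where $0\leq v\leq\frac{a}{3}-1$ and $\frac{a}{3}+1\leq r\leq\frac{2a}{3}-v$, \item[(vi)] $-(r+1)g_2+g_3$ where $0\leq r\leq\frac{a}{3}-1$, \item[(vii)] $-(2v+2)g_1-(v(a+3)+\frac{2a}{3}+3)g_2+(3v+4)g_3$ where $0\leq v\leq\frac{a}{3}-1$, \item[(viii)] $-(2v+2)g_1-(v(a+3)+\frac{4a}{3}-v+3)g_2+(3v+4)g_3$ where $\frac{a}{3}\leq v\leq\frac{2a}{3}-1$. \end{itemize}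 The elements in (ii)--(iv) have minimal trace $2$, while those in (i) and (v)--(viii) have minimal trace $1$. The total number of indecomposables in $K$ up to multiplication by totally positive units is $\frac{a^2+3a}{18}+2a+2$.
   Context: An element of $K$ is totally positive if all its images under the three real embeddings are positive. An indecomposable integer is a totally positive $\alpha\in\mathcal{O}_K$ that cannot be written as a sum of two totally positive elements of $\mathcal{O}_K$. The codifferent is $\mathcal{O}_K^{\vee}=\{\delta\in K:\mathrm{Tr}(\delta\alpha)\in\mathbb{Z}\ \forall\alpha\in\mathcal{O}_K\}$, and the minimal trace of a totally positive $\alpha\in\mathcal{O}_K$ is $\min\{\mathrm{Tr}(\delta\alpha):\delta\in\mathcal{O}_K^{\vee}\text{ totally positive}\}$. ''Up to multiplication by totally positive units'' means every indecomposable is a totally positive unit times one of the listed elements. *)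

(* Defs.v *)
(* The cubic field K = Q(rho) is realised inside algC:
   an element of K is given by its rational coordinates (x,y,z) in the
   power basis 1, rho, rho^2; its three conjugates (images under the three
   embeddings of K) are x + y t + z t^2 for t ranging over the three roots
   rho, r2, r3 of the defining polynomial. *)
From HB Require Import structures.
From mathcomp Require Import all_boot all_order all_algebra all_field.
Set Implicit Arguments. Unset Strict Implicit. Unset Printing Implicit Defensive.
Import Order.TTheory GRing.Theory Num.Theory.
Local Open Scope ring_scope.

Definition cubpoly (a : nat) : {poly algC} :=
  'X^3 - (a%:R) *: 'X^2 - ((a + 3)%:R) *: 'X - 1.

Definition squarefree (n : nat) : Prop :=
  forall p : nat, prime p -> ~ (p ^ 2 %| n)%N.

Definition Kel := (rat * rat * rat)%type.

Definition emb (t : algC) (c : Kel) : algC :=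
  ratr c.1.1 + ratr c.1.2 * t + ratr c.2 * t ^+ 2.

(* element c1 g1 + c2 g2 + c3 g3, g1 = 1, g2 = rho, g3 = (1+rho+rho^2)/3 *)
Definition gel (c1 c2 c3 : rat) : Kel := (c1 + c3 / 3, c2 + c3 / 3, c3 / 3).

Section Field.
Variables rho r2 r3 : algC.

Definition inOK (c : Kel) : Prop := emb rho c \in Aint.

Definition totpos (c : Kel) : Prop :=
  0 < emb rho c /\ 0 < emb r2 c /\ 0 < emb r3 c.

Definition indecomposable (c : Kel) : Prop :=
  inOK c /\ totpos c /\
  ~ (exists d e : Kel, inOK d /\ totpos d /\ inOK e /\ totpos e /\
                       emb rho c = emb rho d + emb rho e).

Definition isunit (e : Kel) : Prop :=
  inOK e /\ exists f : Kel, inOK f /\ emb rho e * emb rho f = 1.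

Definition tpunit (e : Kel) : Prop := isunit e /\ totpos e.

(* Tr(d * c) = sum of the conjugates of d * c *)
Definition trmul (d c : Kel) : algC :=
  emb rho d * emb rho c + emb r2 d * emb r2 c + emb r3 d * emb r3 c.

Definition codiff (d : Kel) : Prop :=
  forall c : Kel, inOK c -> trmul d c \is a Num.int.

Definition min_trace_is (c : Kel) (n : nat) : Prop :=
  (exists d : Kel, codiff d /\ totpos d /\ trmul d c = n%:R) /\
  (forall d : Kel, codiff d -> totpos d -> n%:R <= trmul d c).

Definition tp_assoc (c c' : Kel) : Prop :=
  exists e : Kel, tpunit e /\ emb rho c = emb rho e * emb rho c'.

End Field.

Definition rng (a : nat) : seq nat := iota 0 a.+1.

Definition nr (n : nat) : rat := n%:R.

Definition list_i (a : nat) : seq Kel := [:: gel 0 0 1].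
Definition list_v (a : nat) : seq Kel :=
  [seq gel (- (2 * nr p.1 + 1)) (- (nr p.1 * (nr a + 3) + nr p.2 + 1)) (3 * nr p.1 + 2)
  | p <- [seq q <- allpairs pair (rng a) (rng a) |
          (3 * q.1 + 3 <= a)%N && (a + 3 <= 3 * q.2)%N && (3 * q.2 <= 2 * a - 3 * q.1)%N]].
Definition list_vi (a : nat) : seq Kel :=
  [seq gel 0 (- (nr r + 1)) 1 | r <- [seq r <- rng a | (3 * r + 3 <= a)%N]].
Definition list_vii (a : nat) : seq Kel :=
  [seq gel (- (2 * nr v + 2)) (- (nr v * (nr a + 3) + 2 * nr a / 3 + 3)) (3 * nr v + 4)
  | v <- [seq v <- rng a | (3 * v + 3 <= a)%N]].
Definition list_viii (a : nat) : seq Kel :=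
  [seq gel (- (2 * nr v + 2)) (- (nr v * (nr a + 3) + 4 * nr a / 3 - nr v + 3)) (3 * nr v + 4)
  | v <- [seq v <- rng a | (a <= 3 * v)%N && (3 * v + 3 <= 2 * a)%N]].

Definition list_ii (a : nat) : seq Kel :=
  [seq gel (-1) (- (nr r + 1)) 3 | r <- [seq r <- rng a | (1 <= r)%N && (3 * r <= a)%N]].
Definition list_iii (a : nat) : seq Kel :=
  [seq gel (- (2 * nr v + 1)) (- (nr v * (nr a + 3) + 2)) (3 * (nr v + 1))
  | v <- [seq v <- rng a | (2 * a + 3 <= 3 * v)%N && (v <= a)%N]].
Definition list_iv (a : nat) : seq Kel :=
  [seq gel (- (2 * nr v + 1)) (- ((nr v + 1) * (nr a + 2))) (3 * (nr v + 1))
  | v <- [seq v <- rng a | (3 * v + 3 <= a)%N]].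

Definition list_tr1 (a : nat) : seq Kel :=
  list_i a ++ list_v a ++ list_vi a ++ list_vii a ++ list_viii a.
Definition list_tr2 (a : nat) : seq Kel := list_ii a ++ list_iii a ++ list_iv a.

Definition indec_list (a : nat) : seq Kel := gel 1 0 0 :: list_tr1 a ++ list_tr2 a.

(* Main.v *)
(* Write a = 9 m + 3 and let s be the automorphism rho |-> -1 - 1/rho.  The
   forms k(x) = Tr(delta0 x) and psi(x) = Tr(delta1 x) with delta0, delta1
   totally positive in the codifferent take positive integral values on totally
   positive integers.  With e3 = rho^2/(1 + rho)^2, the map tau(x) = e3 s(x)
   preserves k and integrality and permutes 1, e3, rho^2; in suitable lattice
   coordinates (k; n1, n2, n3) it is the cyclic shift, which reduces the families
   (ii)-(iv) and (vi)-(viii) to one family each.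

   Completeness: among the multiples of x by totally positive units take one
   with k locally minimal.  If it lies outside the cone C spanned by
   1, rho^2, e3, minimality makes it (up to tau) a nonnegative integral
   combination of 1, rho^2, g3, hence g3 when indecomposable.  Inside C, a
   case analysis on k decomposes everything but the listed elements.

   Non-associatedness: k >= 3 on totally positive units, with equality only at
   1, rho^2, e3.  A listed element c other than 1, g3 is interior to C, so
   k(e c) >= k(c) for every totally positive unit e, with equality only for
   e = 1.

   Minimal traces: k = 1 on (v) and psi = 1 on g3 and (vi).  An element c of (ii)
   has psi(c) = 2, and a multiple N c is a sum of more than N totally positive
   integers, so Tr(d c) > 1 for all totally positive d in the codifferent. *)
Require Import Defs.
From HB Require Import structures.
From mathcomp Require Import all_boot all_order all_algebra all_field.
From mathcomp Require Import ring lra zify.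
Import Order.TTheory GRing.Theory Num.Theory.
Local Open Scope ring_scope.

(** * The field in the power basis *)

(** Integers are defined by algebraic integrality, so the integral basis has to be proved. The
    discriminant of 1, rho, g3 is (9 del)^2 with del = 3 m^2 + 3 m + 1 = (a^2 + 3 a + 9)/27:
    squarefreeness of del settles the primes dividing del, and the exclusion of 12 mod 27 settles
    the prime 3. Its place is taken by the linear form k: every question about unit multiples
    becomes an inequality between values of k, and the vertices of C are the totally positive units
    at which k is least. Since s fixes 1, it cannot rotate these vertices; the twist by e3 in tau
    repairs this. Beyond the face of C on 1 and rho^2 lies g3, and 1, rho^2, g3 is a Z-basis of the
    integers, so local minimality there only has to control the signs of integral coordinates.
    Inside C, a vertex can be subtracted as soon as its coefficient reaches 1; otherwise k < 9,
    which makes the case analysis finite in k, uniformly in m. *)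

(* The operations are sealed so that unification never compares two of them by
   computing with rational numbers. *)
HB.lock Definition addK (x y : Kel) : Kel :=
  (x.1.1 + y.1.1, x.1.2 + y.1.2, x.2 + y.2).

HB.lock Definition scaleK (q : rat) (x : Kel) : Kel :=
  (q * x.1.1, q * x.1.2, q * x.2).

HB.lock Definition oneK : Kel := (1, 0, 0).

(* rho^3 = a rho^2 + (a + 3) rho + 1 and
   rho^4 = (a^2 + a + 3) rho^2 + (a^2 + 3 a + 1) rho + a *)
HB.lock Definition mulK (a : rat) (x y : Kel) : Kel :=
  let z3 := x.1.2 * y.2 + x.2 * y.1.2 in
  let z4 := x.2 * y.2 in
  (x.1.1 * y.1.1 + z3 + a * z4,
   x.1.1 * y.1.2 + x.1.2 * y.1.1 + (a + 3) * z3 + (a ^+ 2 + 3 * a + 1) * z4,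
   x.1.1 * y.2 + x.1.2 * y.1.2 + x.2 * y.1.1 + a * z3 + (a ^+ 2 + a + 3) * z4).

(* The automorphism rho |-> -1 - 1/rho = a + 2 + a rho - rho^2; its square
   maps rho to -1/(1 + rho). *)
HB.lock Definition sgK (a : rat) (x : Kel) : Kel :=
  (x.1.1 + (a + 2) * x.1.2 + (a ^+ 2 + 3 * a + 4) * x.2,
   a * x.1.2 + (a ^+ 2 + a + 1) * x.2, - x.1.2 - (a + 1) * x.2).

HB.lock Definition traceK (a : rat) (x : Kel) : rat :=
  3 * x.1.1 + a * x.1.2 + (a ^+ 2 + 2 * a + 6) * x.2.

HB.lock Definition normK (a : rat) (c : Kel) : rat :=
  let x := c.1.1 in let y := c.1.2 in let z := c.2 in
  x ^+ 3 + y ^+ 3 + z ^+ 3 + a * x ^+ 2 * y + (a ^+ 2 + 2 * a + 6) * x ^+ 2 * z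
  - (a + 3) * x * y ^+ 2 + (a ^+ 2 + 4 * a + 9) * x * z ^+ 2
  + a * y ^+ 2 * z - (a + 3) * y * z ^+ 2 - (a ^+ 2 + 3 * a + 3) * x * y * z.

Ltac unlockK :=
  rewrite ?addK.unlock ?scaleK.unlock ?mulK.unlock ?sgK.unlock ?traceK.unlock
    ?normK.unlock ?oneK.unlock.

Section CubicField.
Variable a : rat.
Local Notation mulK := (mulK a).
Local Notation sgK := (sgK a).
Local Notation traceK := (traceK a).
Local Notation normK := (normK a).

Local Ltac Kring :=
  repeat match goal with x : Kel |- _ => destruct x as [[? ?] ?] end;
  unlockK => /=;
  try (congr (_, _, _)); ring.

Lemma mulKC (x y : Kel) : mulK x y = mulK y x. Proof. Kring. Qed.
Lemma mulKA (x y z : Kel) : mulK x (mulK y z) = mulK (mulK x y) z.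
Proof. Kring. Qed.
Lemma mul1K (x : Kel) : mulK oneK x = x. Proof. Kring. Qed.
Lemma mulKDr (x y z : Kel) : mulK z (addK x y) = addK (mulK z x) (mulK z y).
Proof. Kring. Qed.
Lemma sgKD (x y : Kel) : sgK (addK x y) = addK (sgK x) (sgK y).
Proof. Kring. Qed.
Lemma sgKM (x y : Kel) : sgK (mulK x y) = mulK (sgK x) (sgK y).
Proof. Kring. Qed.
Lemma sgK3 (x : Kel) : sgK (sgK (sgK x)) = x. Proof. Kring. Qed.
Lemma traceK_sgK (x : Kel) : traceK (sgK x) = traceK x. Proof. Kring. Qed.
Lemma traceKD (x y : Kel) : traceK (addK x y) = traceK x + traceK y.
Proof. Kring. Qed.

Definition isroot (r : algC) : Prop :=
  r ^+ 3 = ratr a * r ^+ 2 + (ratr a + 3) * r + 1.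

Definition conjr (r : algC) : algC := - 1 - r^-1.

Lemma isroot_neq0 (r : algC) : isroot r -> r != 0.
Proof.
move=> hr; apply/eqP => r0; move: hr; rewrite /isroot r0; move/eqP.
by rewrite !expr0n /= !mulr0 !add0r eq_sym oner_eq0.
Qed.

Lemma isroot_addr1_neq0 (r : algC) : isroot r -> 1 + r != 0.
Proof.
move=> hr; apply/eqP => r1.
(* Division of the cubic by 1 + r: its value at -1 is 1. *)
have : (1 : algC) = (1 + r) * (2 + (ratr a + 1) * r - r ^+ 2) +
   (r ^+ 3 - (ratr a * r ^+ 2 + (ratr a + 3) * r + 1)) by ring.
by rewrite r1 hr mul0r subrr addr0 => /eqP; rewrite oner_eq0.
Qed.

(** The cubic is linear in [a]. Eliminating [a] turns identities modulo the cubic into rational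
    identities in [r], within reach of [field]. *)
Lemma isroot_a (r : algC) : isroot r ->
  ratr a = (r ^+ 3 - 3 * r - 1) / (r * (1 + r)).
Proof.
move=> hr; have r0 := isroot_neq0 r hr; have r1 := isroot_addr1_neq0 r hr.
by rewrite hr; field; rewrite ?r0 ?r1.
Qed.

Lemma isroot_conjr (r : algC) : isroot r -> isroot (conjr r).
Proof.
move=> hr; have r0 := isroot_neq0 r hr; have r1 := isroot_addr1_neq0 r hr.
by rewrite /isroot (isroot_a r hr) /conjr; field; rewrite ?r0 ?r1.
Qed.

Lemma conjr_conjr (r : algC) : isroot r -> conjr (conjr r) = - (1 + r)^-1.
Proof.
move=> hr; have r0 := isroot_neq0 r hr; have r1 := isroot_addr1_neq0 r hr.
have c0 := isroot_neq0 _ (isroot_conjr r hr).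
have -> : conjr r = - ((1 + r) / r) by rewrite /conjr; field.
by rewrite /conjr; field; rewrite ?r0 ?r1.
Qed.

Lemma conjr3 (r : algC) : isroot r -> conjr (conjr (conjr r)) = r.
Proof.
move=> hr; rewrite (conjr_conjr _ (isroot_conjr r hr)) /conjr.
by rewrite addrA subrr add0r invrN opprK invrK.
Qed.

Lemma isroot_cases (r z : algC) : isroot r -> isroot z ->
  [\/ z = r, z = conjr r | z = conjr (conjr r)].
Proof.
move=> hr hz; have r0 := isroot_neq0 r hr; have r1 := isroot_addr1_neq0 r hr.
have : (z - r) * (z - conjr r) * (z - conjr (conjr r)) = 0.
  rewrite (conjr_conjr r hr) /conjr.
  have -> : (z - r) * (z - (- 1 - r^-1)) * (z - - (1 + r)^-1) =
    z ^+ 3 - ((r ^+ 3 - 3 * r - 1) / (r * (1 + r)) * z ^+ 2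
              + ((r ^+ 3 - 3 * r - 1) / (r * (1 + r)) + 3) * z + 1).
    by field; rewrite ?r0 ?r1.
  by rewrite -(isroot_a r hr) hz subrr.
move/eqP; rewrite !mulf_eq0 => /orP[/orP[]|] /eqP/subr0_eq ->.
- exact: Or31.
- exact: Or32.
- exact: Or33.
Qed.

(** The complex conjugate of [r] is again a root, hence one of the three known ones. In the two
    nontrivial cases the relation between them expresses [r] or its conjugate through the real
    number r r^*. *)
Lemma isroot_real (r : algC) : isroot r -> r \is Num.real.
Proof.
move=> hr; have r0 := isroot_neq0 r hr; have r1 := isroot_addr1_neq0 r hr.
have hc : isroot r^*.
  have aR : (ratr a : algC)^* = ratr a by rewrite conj_Crat ?Crat_rat.
  move: hr aR; rewrite /isroot; move: (ratr a : algC) => q hr' qR.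
  by rewrite -rmorphXn hr' !(rmorphD, rmorphM, rmorphXn, rmorph1) /= qR.
have nR : r * r^* \is Num.real by rewrite -normCK rpredX ?normr_real.
case: (isroot_cases r _ hr hc) => [/CrealP //| e | e].
- have -> : r = - (r * r^*) - 1.
    by rewrite e /conjr; field.
  by rewrite rpredB ?rpredN ?rpred1.
- have e' : r^* = - (r * r^*) - 1.
    by rewrite e (conjr_conjr r hr); field.
  have : r^* \is Num.real by rewrite e' rpredB ?rpredN ?rpred1.
  by move/CrealP; rewrite conjCK => /esym /CrealP.
Qed.

Lemma emb_add (r : algC) (x y : Kel) : emb r (addK x y) = emb r x + emb r y.
Proof.
case: x y => [[x0 x1] x2] [[y0 y1] y2]; unlockK; rewrite /emb /= !rmorphD /=; ring.
Qed.

Lemma emb_scale (r : algC) (q : rat) (x : Kel) :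
  emb r (scaleK q x) = ratr q * emb r x.
Proof.
by case: x => [[x0 x1] x2]; unlockK; rewrite /emb /= !rmorphM /=; ring.
Qed.

Lemma emb_one (r : algC) : emb r oneK = 1.
Proof. by unlockK; rewrite /emb /= rmorph1 !rmorph0 !mul0r !addr0. Qed.

Lemma emb_mul (r : algC) (x y : Kel) :
  isroot r -> emb r (mulK x y) = emb r x * emb r y.
Proof.
case: x y => [[x0 x1] x2] [[y0 y1] y2] hr; unlockK; rewrite /emb /=.
rewrite !(rmorphD, rmorphM, rmorphXn, rmorph1) /=.
set p := _ + _ * _ ^+ 2; set q := RHS.
pose z3 : algC := ratr x1 * ratr y2 + ratr x2 * ratr y1.
pose z4 : algC := ratr x2 * ratr y2.
have -> : p = q - (z3 + z4 * (r + ratr a)) *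
    (r ^+ 3 - (ratr a * r ^+ 2 + (ratr a + 3) * r + 1)).
  by rewrite /p /q /z3 /z4; ring.
by rewrite hr subrr mulr0 subr0.
Qed.

Lemma emb_sgK (r : algC) (x : Kel) : isroot r -> emb r (sgK x) = emb (conjr r) x.
Proof.
move=> hr; case: x => [[x0 x1] x2]; unlockK; rewrite /emb /=.
rewrite !(rmorphD, rmorphB, rmorphN, rmorphM, rmorphXn, rmorph_nat, rmorph1) /=.
rewrite (isroot_a r hr) /conjr.
by field; rewrite (isroot_neq0 r hr) (isroot_addr1_neq0 r hr).
Qed.

(** Quantifying over all roots, not over three named ones, makes stability under the automorphism
    immediate. *)
Definition tpK (x : Kel) : Prop := forall r, isroot r -> 0 < emb r x.

Lemma emb_real (r : algC) (x : Kel) : isroot r -> emb r x \is Num.real.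
Proof.
move=> hr; have rR := isroot_real r hr.
have qR (q : rat) : (ratr q : algC) \is Num.real by rewrite Creal_Crat ?Crat_rat.
by rewrite /emb; do 4?[exact: qR | exact: rR | apply: realD | apply: realM | apply: realX].
Qed.

Lemma tpK_add (x y : Kel) : tpK x -> tpK y -> tpK (addK x y).
Proof. by move=> hx hy r hr; rewrite emb_add addr_gt0 ?hx ?hy. Qed.

Lemma tpK_mul (x y : Kel) : tpK x -> tpK y -> tpK (mulK x y).
Proof. by move=> hx hy r hr; rewrite emb_mul ?mulr_gt0 ?hx ?hy. Qed.

Lemma tpK_scale (q : rat) (x : Kel) : 0 < q -> tpK x -> tpK (scaleK q x).
Proof. by move=> q0 hx r hr; rewrite emb_scale mulr_gt0 ?hx ?ltr0q. Qed.

Lemma tpK_sgK (x : Kel) : tpK x -> tpK (sgK x).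
Proof. by move=> hx r hr; rewrite emb_sgK ?hx //; apply: isroot_conjr. Qed.

Lemma tpK_one : tpK oneK.
Proof. by move=> r _; rewrite emb_one ltr01. Qed.

Lemma tpK_sqr (x y : Kel) : mulK x y = oneK -> tpK (mulK x x).
Proof.
move=> xy r hr; rewrite emb_mul // -expr2.
rewrite real_exprn_even_gt0 ?emb_real //=; apply/eqP => x0.
have := emb_one r; rewrite -xy emb_mul // x0 mul0r => /eqP.
by rewrite eq_sym oner_eq0.
Qed.

Lemma emb_traceK (x : Kel) (r : algC) : isroot r ->
  ratr (traceK x) = emb r x + emb (conjr r) x + emb (conjr (conjr r)) x.
Proof.
move=> hr; have hr' := isroot_conjr r hr.
rewrite -(emb_sgK (conjr r)) // -(emb_sgK r) // -(emb_sgK r) // -!emb_add.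
have -> : addK (addK x (sgK x)) (sgK (sgK x)) = (traceK x, 0, 0) by Kring.
by rewrite /emb /= !rmorph0 !mul0r !addr0.
Qed.

Definition adjK (c : Kel) : Kel :=
  let x := c.1.1 in let y := c.1.2 in let z := c.2 in
  (x ^+ 2 + (a ^+ 2 + 2 * a + 6) * x * z + a * x * y - (a ^+ 2 + 3 * a + 1) * y * z
     - (a + 3) * y ^+ 2 + (a ^+ 2 + 5 * a + 9) * z ^+ 2,
   - a * y ^+ 2 + (a ^+ 2 + 3 * a + 1) * z ^+ 2 - a ^+ 2 * y * z - x * y,
   a * y * z - (a + 3) * z ^+ 2 - x * z + y ^+ 2).

Lemma adjKE (x : Kel) : adjK x = mulK (sgK x) (sgK (sgK x)).
Proof. rewrite /adjK; Kring. Qed.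

Lemma mulK_adjK (x : Kel) : mulK x (adjK x) = (normK x, 0, 0).
Proof. rewrite /adjK; Kring. Qed.

Lemma emb_normK (x : Kel) (r : algC) : isroot r ->
  ratr (normK x) = emb r x * (emb (conjr r) x * emb (conjr (conjr r)) x).
Proof.
move=> hr; have hr' := isroot_conjr r hr.
rewrite -(emb_sgK (conjr r)) // -(emb_sgK r) // -(emb_sgK r) // -!emb_mul //.
rewrite -adjKE mulK_adjK.
by rewrite /emb /= !rmorph0 !mul0r !addr0.
Qed.

End CubicField.

(** * Irreducibility and conjugates *)

Section Integrality.
Variable n : nat.
Local Notation a := (n%:R : rat).

Definition cubR (R : comNzRingType) : {poly R} :=
  'X^3 - n%:R *: 'X^2 - (n + 3)%:R *: 'X - 1.

Lemma cubRE (R : comNzRingType) :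
  cubR R = 'X^3 - (n%:R *: 'X^2 + (n + 3)%:R *: 'X + 1).
Proof. by rewrite /cubR !opprD !addrA. Qed.

Lemma size_cubR_tail (R : comNzRingType) :
  (size (n%:R *: 'X^2 + (n + 3)%:R *: 'X + 1 : {poly R})%R < 4)%N.
Proof.
rewrite (leq_ltn_trans (size_polyD _ _)) // gtn_max size_poly1 andbT.
rewrite (leq_ltn_trans (size_polyD _ _)) // gtn_max.
rewrite (leq_ltn_trans (size_scale_leq _ _)) ?size_polyXn //=.
by rewrite (leq_ltn_trans (size_scale_leq _ _)) ?size_polyX.
Qed.

Lemma size_cubR (R : comNzRingType) : size (cubR R) = 4.
Proof. by rewrite cubRE size_polyDl ?size_polyN size_polyXn ?size_cubR_tail. Qed.

Lemma monic_cubR (R : comNzRingType) : cubR R \is monic.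
Proof.
apply/monicP; rewrite cubRE lead_coefDl ?lead_coefXn //.
by rewrite size_polyN size_polyXn size_cubR_tail.
Qed.

Lemma map_cubR (R S : comNzRingType) (f : {rmorphism R -> S}) :
  map_poly f (cubR R) = cubR S.
Proof.
by rewrite /cubR !rmorphB /= !map_polyZ !map_polyXn map_polyX rmorph1 !rmorph_nat.
Qed.

Lemma horner_cubR (R : comNzRingType) (x : R) :
  (cubR R).[x] = x ^+ 3 - (n%:R * x ^+ 2 + (n%:R + 3) * x + 1).
Proof. rewrite /cubR (natrD _ n 3) !hornerE. by ring. Qed.

Lemma root_cubR (r : algC) : root (cubR algC) r <-> isroot a r.
Proof.
rewrite /root horner_cubR subr_eq0 /isroot ratr_nat; split; first by move/eqP.
by move/eqP.
Qed.

(** A rational root is an algebraic integer, hence an integer dividing the constant term 1; but the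
    values at 1 and -1 are -2n - 3 and 1. *)
Lemma cubR_no_root (q : rat) : ~~ root (cubR rat) q.
Proof.
apply/negP => hq.
have hroot : root (cubR algC) (ratr q).
  by rewrite -(map_cubR _ _ (ratr : {rmorphism rat -> algC})) fmorph_root.
have : (ratr q : algC) \in Aint.
  apply: root_monic_Aint hroot (monic_cubR _) _.
  apply/polyOverP => i; rewrite -(map_cubR _ _ (intr : {rmorphism int -> algC})).
  by rewrite coef_map /= intr_int.
move=> /(Cint_rat_Aint (Crat_rat q)) /intrP [z hz].
have qz : q = z%:~R.
  by apply: (fmorph_inj (ratr : {rmorphism rat -> algC})); rewrite /= hz ratr_int.
have hz3 : z * (z ^+ 2 - n%:Z * z - (n%:Z + 3)) = 1.
  move: hq; rewrite qz -(map_cubR _ _ (intr : {rmorphism int -> rat})) /root.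
  rewrite horner_map /= horner_cubR intr_eq0 subr_eq0 => /eqP hz3.
  have -> : z * (z ^+ 2 - n%:Z * z - (n%:Z + 3)) =
            z ^+ 3 - (n%:Z * z ^+ 2 + (n%:Z + 3) * z) by ring.
  by rewrite hz3 natz; ring.
have := congr1 absz hz3; rewrite abszM absz1 => /eqP; rewrite muln_eq1 => /andP[/eqP hz1 _].
have : z = 1 \/ z = -1 by lia.
by case=> e; move: hz3; rewrite e; lia.
Qed.

Lemma irreducible_cubR : irreducible_poly (cubR rat).
Proof. by apply: cubic_irreducible => [|x]; rewrite ?size_cubR ?cubR_no_root. Qed.

(** By irreducibility the minimal polynomial of [r] is the cubic. The right side no longer mentions
    [r], so rational relations pass from one root to any other. *)
Lemma rat_root_dvd (r : algC) (p : {poly rat}) : isroot a r ->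
  root (map_poly ratr p) r = (cubR rat %| p).
Proof.
move=> hr; have [q [Dq mon_q] dv_q] := minCpolyP r.
have hq : q %| cubR rat by rewrite -dv_q map_cubR; apply/root_cubR.
rewrite dv_q; apply: eqp_dvdl.
have [_ irr] := irreducible_cubR; apply: irr => //.
rewrite -(size_map_poly (ratr : {rmorphism rat -> algC})) -Dq.
by rewrite neq_ltn size_minCpoly orbT.
Qed.

Definition polyK (x : Kel) : {poly rat} := x.1.1%:P + x.1.2 *: 'X + x.2 *: 'X^2.

Lemma horner_polyK (r : algC) (x : Kel) : (map_poly ratr (polyK x)).[r] = emb r x.
Proof.
rewrite /polyK !rmorphD /= !map_polyZ map_polyXn map_polyX map_polyC /=.
by rewrite !hornerE /emb /=; ring.
Qed.

Lemma emb_eq0 (r : algC) (x : Kel) : isroot a r -> emb r x = 0 -> x = (0, 0, 0).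
Proof.
move=> hr hx; have : root (map_poly ratr (polyK x)) r.
  by apply/rootP; rewrite horner_polyK.
rewrite (rat_root_dvd _ _ hr) => dv.
have px0 : polyK x = 0.
  apply/eqP; apply: contraTT dv => nz; apply/negP => /(dvdp_leq nz).
  rewrite size_cubR leqNgt (leq_ltn_trans (size_polyD _ _)) // gtn_max.
  rewrite (leq_ltn_trans (size_polyD _ _)) // ?gtn_max.
    by rewrite (leq_ltn_trans (size_scale_leq _ _)) ?size_polyXn.
  rewrite (leq_ltn_trans (size_polyC_leq1 _)) //.
  by rewrite (leq_ltn_trans (size_scale_leq _ _)) ?size_polyX.
case: x px0 {hx dv} => [[x0 x1] x2] /polyP px0.
have := (px0 0, px0 1, px0 2); rewrite /polyK !coefE /= !mulr0 !mulr1 !addr0 !add0r.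
by case=> [[-> ->] ->].
Qed.

Lemma emb_inj (r : algC) (x y : Kel) : isroot a r -> emb r x = emb r y -> x = y.
Proof.
move=> hr hxy; have : emb r (addK x (scaleK (-1) y)) = 0.
  by rewrite emb_add emb_scale hxy rmorphN rmorph1 mulN1r subrr.
move/(emb_eq0 _ _ hr); case: x y {hxy} => [[x0 x1] x2] [[y0 y1] y2].
unlockK => -[] e0 e1 e2; congr (_, _, _); lra.
Qed.

(** The minimal polynomial of [emb r x], composed with [polyK x], vanishes at [r], hence at [s]. *)
Lemma Aint_conj (r s : algC) (x : Kel) : isroot a r -> isroot a s ->
  emb r x \in Aint -> emb s x \in Aint.
Proof.
move=> hr hs hx; have [q [Dq mon_q] _] := minCpolyP (emb r x).
have comp t : (map_poly ratr (q \Po polyK x)).[t] = (map_poly ratr q : {poly algC}).[emb t x].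
  by rewrite map_comp_poly horner_comp horner_polyK.
have : root (map_poly ratr (q \Po polyK x)) r.
  by rewrite /root comp -Dq; exact: root_minCpoly.
rewrite (rat_root_dvd _ _ hr) -(rat_root_dvd _ _ hs) /root comp -Dq => hrs.
by apply: root_monic_Aint hrs (minCpoly_monic _) _.
Qed.
End Integrality.

(** * The integral basis *)

Lemma rat_Aint_int (q : rat) : (ratr q : algC) \in Aint -> exists z : int, q = z%:~R.
Proof.
move=> /(Cint_rat_Aint (Crat_rat q)) /intrP [z hz]; exists z.
by apply: (fmorph_inj (ratr : {rmorphism rat -> algC})); rewrite /= hz ratr_int.
Qed.

Lemma Euclid_dvdzM (p : nat) (x y : int) : prime p ->
  (p %| x * y)%Z = (p %| x)%Z || (p %| y)%Z.
Proof. by move=> pp; rewrite !dvdzE abszM Euclid_dvdM. Qed.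

Lemma prime_dvdz_cube (p : nat) (x : int) : prime p ->
  (p %| x ^+ 3)%Z = (p %| x)%Z.
Proof. by move=> pp; rewrite 2!exprS expr1 !Euclid_dvdzM // !orbb. Qed.

Lemma Aint_cubic (x : algC) (t s c : int) :
  x ^+ 3 = t%:~R * x ^+ 2 + s%:~R * x + c%:~R -> x \in Aint.
Proof.
move=> hx; pose tail : {poly int} := t *: 'X^2 + s *: 'X + c%:P.
have tail4 : (size tail < 4)%N.
  rewrite (leq_ltn_trans (size_polyD _ _)) // gtn_max.
  rewrite (leq_ltn_trans (size_polyC_leq1 _)) // andbT.
  rewrite (leq_ltn_trans (size_polyD _ _)) // gtn_max.
  rewrite (leq_ltn_trans (size_scale_leq _ _)) ?size_polyXn //=.
  by rewrite (leq_ltn_trans (size_scale_leq _ _)) ?size_polyX.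
have root_x : root (map_poly intr ('X^3 - tail)) x.
  apply/rootP; rewrite /tail rmorphB !rmorphD /= !map_polyZ !map_polyXn map_polyX map_polyC /=.
  by rewrite !(hornerD, hornerN, hornerZ, hornerXn, hornerX, hornerC) hx subrr.
apply: root_monic_Aint root_x _ _.
  apply: monic_map; apply/monicP; rewrite lead_coefDl ?lead_coefXn //.
  by rewrite size_polyN size_polyXn.
by apply/polyOverP => i; rewrite coef_map /= intr_int.
Qed.

Section IntegralBasis.
Variable m : nat.
Local Notation n := (9 * m + 3)%N.
Local Notation a := (n%:R : rat).
Local Notation M := (m%:R : rat).

Lemma aE : a = 9 * M + 3. Proof. by rewrite natrD natrM. Qed.

Definition intK (x : Kel) : Prop :=
  exists c1 c2 c3 : int, x = gel c1%:~R c2%:~R c3%:~R.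

Variable r : algC.
Hypothesis hr : isroot a r.

Lemma intK_inOK (x : Kel) : intK x -> inOK r x.
Proof.
have rA : r \in Aint.
  apply: (Aint_cubic _ n (n%:Z + 3) 1); rewrite hr ratr_nat.
  by ring.
pose d := 3 * m%:Z ^+ 2 + 3 * m%:Z + 1.
(* The characteristic polynomial of g3 is x^3 - 9 d x^2 + 6 d x - d with d = (n^2 + 3 n + 9)/27; it
   is integral because n = 9 m + 3. *)
have gA : emb r (gel 0 0 1) \in Aint.
  apply: (Aint_cubic _ (9 * d) (- (6 * d)) d).
  set g := gel 0 0 1.
  have /(congr1 (emb r)) : mulK a g (mulK a g g) =
      addK (addK (scaleK (9 * d)%:~R (mulK a g g)) (scaleK (- (6 * d))%:~R g))
           (scaleK d%:~R oneK).
    unlockK; rewrite /g /gel /= aE /d.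
    by congr (_, _, _); field.
  rewrite !emb_add !emb_scale emb_one !(emb_mul a _ _ _ hr) !ratr_int mulr1 => <-.
  by rewrite 2!exprS expr1.
case=> c1 [c2 [c3 ->]].
have -> : gel c1%:~R c2%:~R c3%:~R =
  addK (addK (scaleK c1%:~R oneK) (scaleK c2%:~R (0, 1, 0))) (scaleK c3%:~R (gel 0 0 1)).
  by unlockK; rewrite /gel /=; congr (_, _, _); field.
rewrite /inOK !emb_add !emb_scale !ratr_int emb_one.
have -> : emb r (0, 1, 0) = r by rewrite /emb /= !rmorph0 rmorph1 mul0r mul1r add0r addr0.
by rewrite !rpredD ?rpredM ?Aint_int ?rpred1.
Qed.

Lemma traceK_int (x : Kel) : inOK r x -> exists z : int, traceK a x = z%:~R.
Proof.
move=> hx; apply: rat_Aint_int; rewrite (emb_traceK _ _ _ hr).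
have h1 := isroot_conjr _ _ hr; have h2 := isroot_conjr _ _ h1.
rewrite /inOK in hx; have x1 := Aint_conj _ _ _ _ hr h1 hx; have x2 := Aint_conj _ _ _ _ hr h2 hx.
exact: rpredD (rpredD hx x1) x2.
Qed.

Lemma normK_int (x : Kel) : inOK r x -> exists z : int, normK a x = z%:~R.
Proof.
move=> hx; apply: rat_Aint_int; rewrite (emb_normK _ _ _ hr).
have h1 := isroot_conjr _ _ hr; have h2 := isroot_conjr _ _ h1.
rewrite /inOK in hx; have x1 := Aint_conj _ _ _ _ hr h1 hx; have x2 := Aint_conj _ _ _ _ hr h2 hx.
exact: rpredM hx (rpredM x1 x2).
Qed.

Lemma inOK_mul (x y : Kel) : inOK r x -> inOK r y -> inOK r (mulK a x y).
Proof. by rewrite /inOK emb_mul //; apply: rpredM. Qed.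

(** These are (n^2 + 3 n + 9)/27 and (2 n + 3)/9. The relation 4 del - 3 bet^2 = 1 makes them
    coprime. The ring varies because divisibility lives in [int] and coordinates in [rat]. *)
Definition del (R : pzRingType) : R := 3 * m%:R ^+ 2 + 3 * m%:R + 1.
Definition bet (R : pzRingType) : R := 2 * m%:R + 1.

(* Coordinates in the basis 1, y = rho - a/3, w = y^2/3, for which
   y w = 3 del (y + bet) and w^2 = 3 del w + del bet y. *)
Definition bK (u v z : rat) : Kel :=
  let A := 3 * M + 1 in
  (u - A * v + A ^+ 2 / 3 * z, v - 2 * A / 3 * z, z / 3).

(** Since y^3 = 9 del (y + bet), all coefficients other than that of u^3 are divisible by 3 del. *)
Definition normB (R : pzRingType) (u v z : R) : R :=
  let d := del R in let b := bet R in
  u ^+ 3 + 6 * d * u ^+ 2 * z - 9 * d * u * v ^+ 2 - 9 * d * b * u * v * z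
  + 9 * d ^+ 2 * u * z ^+ 2 - 9 * d ^+ 2 * b * v * z ^+ 2
  + 9 * d * b * v ^+ 3 + 3 * d ^+ 2 * b ^+ 2 * z ^+ 3.

Lemma normK_bK (u v z : rat) : normK a (bK u v z) = normB rat u v z.
Proof.
unlockK; rewrite /bK /normB /del /bet aE /=; move: M => M'.
by field.
Qed.

Lemma bK_surj (x : Kel) : exists u v z, x = bK u v z.
Proof.
case: x => [[x0 x1] x2].
exists (x0 + (3 * M + 1) * (x1 + 2 * (3 * M + 1) * x2) - (3 * M + 1) ^+ 2 * x2).
exists (x1 + 2 * (3 * M + 1) * x2), (3 * x2).
rewrite /bK; move: M => M'; congr (_, _, _); by field.
Qed.

Lemma bKD (u v z u' v' z' : rat) :
  addK (bK u v z) (bK u' v' z') = bK (u + u') (v + v') (z + z').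
Proof. by unlockK; rewrite /bK /=; move: M => M'; congr (_, _, _); by field. Qed.

Lemma bK_gel (u v z : int) : intK (bK u%:~R v%:~R z%:~R).
Proof.
pose A := 3 * m%:Z + 1; pose b : int := 2 * m%:Z + 1.
pose d := 3 * m%:Z ^+ 2 + 3 * m%:Z + 1.
exists (u - A * v + (A * b - d) * z), (v - b * z), z.
by rewrite /bK /gel /A /b /d; congr (_, _, _); field.
Qed.

Lemma bK_int (u v z : int) : inOK r (bK u%:~R v%:~R z%:~R).
Proof. exact/intK_inOK/bK_gel. Qed.

Lemma inOK_cancel (x y : Kel) : inOK r x -> inOK r (addK x y) -> inOK r y.
Proof.
rewrite /inOK emb_add => hx hxy; rewrite -(addrK (emb r x) (emb r y)) addrC.
by rewrite (addrC (emb r y)) addrC rpredB.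
Qed.

Lemma normB_dvd (p : nat) (u v z : int) : (0 < p)%N ->
  inOK r (bK (u%:~R / p%:R) (v%:~R / p%:R) (z%:~R / p%:R)) ->
  exists k : int, normB int u v z = p%:Z ^+ 3 * k.
Proof.
move=> p0 /normK_int [k]; rewrite normK_bK => hk; exists k.
have p0' : (p%:R : rat) != 0 by rewrite pnatr_eq0 -lt0n.
apply: (@intr_inj rat); rewrite rmorphM /= -hk /normB /del /bet.
by field.
Qed.

Lemma bK_div (p : nat) (u v z u' v' z' : int) : (0 < p)%N ->
  inOK r (bK ((u + u' * p)%:~R / p%:R) ((v + v' * p)%:~R / p%:R)
             ((z + z' * p)%:~R / p%:R)) ->
  inOK r (bK (u%:~R / p%:R) (v%:~R / p%:R) (z%:~R / p%:R)).
Proof.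
move=> p0; have p0' : (p%:R : rat) != 0 by rewrite pnatr_eq0 -lt0n.
have e (x y : int) : (x + y * p)%:~R / p%:R = y%:~R + x%:~R / p%:R :> rat by field.
by rewrite !e -bKD; apply: inOK_cancel; exact: bK_int.
Qed.

Lemma delE : del int = Posz (3 * m ^ 2 + 3 * m + 1).
Proof. by rewrite -[RHS]natz /del; ring. Qed.

Lemma betE : bet int = Posz (2 * m + 1).
Proof. by rewrite -[RHS]natz /bet; ring. Qed.

Hypothesis sqf : squarefree (3 * m ^ 2 + 3 * m + 1).
Hypothesis m3 : ~~ (3 %| 2 * m + 1)%N.

(** Integrality of the norm gives p^3 | [normB u v z]. Modulo p this is u^3, so u can be removed.
    For p = 3, prime to del and bet, the remaining form yields z and then v. For p <> 3, p divides
    del exactly once and not bet, and the form yields v and then z. *)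
Lemma prime_step (p : nat) (u v z : int) : prime p ->
  (p %| 3 * (3 * m ^ 2 + 3 * m + 1))%N ->
  inOK r (bK (u%:~R / p%:R) (v%:~R / p%:R) (z%:~R / p%:R)) ->
  [/\ (p %| u)%Z, (p %| v)%Z & (p %| z)%Z].
Proof.
move=> pp pd hx; have p0 := prime_gt0 pp.
have pZ : (p%:Z : int) != 0 by rewrite -lt0n in p0 *; lia.
have pd' : (p %| (3 * del int))%Z.
  by rewrite delE -PoszM dvdzE.
have pu : (p %| u)%Z.
  have [k hk] := normB_dvd _ _ _ _ p0 hx.
  rewrite -(prime_dvdz_cube _ _ pp).
  have -> : u ^+ 3 = p%:Z * (p%:Z ^+ 2 * k) + (3 * del int) *
    (- 2 * u ^+ 2 * z + 3 * u * v ^+ 2 + 3 * bet int * u * v * z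
     - 3 * del int * u * z ^+ 2 + 3 * del int * bet int * v * z ^+ 2
     - 3 * bet int * v ^+ 3 - del int * bet int ^+ 2 * z ^+ 3).
    rewrite mulrA -exprS -hk /normB; by ring.
  by rewrite rpredD // dvdz_mulr.
have {}hx : inOK r (bK (0%:~R / p%:R) (v%:~R / p%:R) (z%:~R / p%:R)).
  apply: (bK_div p 0 v z (u %/ p)%Z 0 0 p0).
  by rewrite add0r divzK // !mul0r !addr0.
have hdiv (x : int) : (p %| x)%Z -> exists y : int, x = y * p%:Z by move/dvdzP.
have p_bet : (p %| del int)%Z -> ~~ (p %| bet int)%Z.
  move=> pdel; apply/negP => pbet.
  have : (p %| 4 * del int - 3 * bet int ^+ 2)%Z.
    by rewrite rpredB ?dvdz_mull ?expr2.
  have -> : 4 * del int - 3 * bet int ^+ 2 = 1 by rewrite /del /bet; ring.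
  by rewrite dvdzE /= dvdn1; case: (p) pp => [|[|]].
have [p3 | p3] := eqVneq p 3%N.
  have ndel : ~~ (p %| del int)%Z.
    by rewrite p3 delE dvdzE !absz_nat -mulnDr dvdn_addr ?dvdn_mulr.
  have nbet : ~~ (p %| bet int)%Z.
    by rewrite p3 betE dvdzE.
  have pz : (p %| z)%Z.
    have [k hk] := normB_dvd _ _ _ _ p0 hx.
    have : (p %| del int * del int * (bet int * bet int) * z ^+ 3)%Z.
      apply/dvdzP; exists (3 * k - del int * bet int * v ^+ 3
        + del int ^+ 2 * bet int * v * z ^+ 2).
      apply: (@mulfI _ 3) => //; move: hk; rewrite /normB p3 => hk.
      have {}hk : 27 * k = 9 * del int * bet int * v ^+ 3 -
        9 * del int ^+ 2 * bet int * v * z ^+ 2 + 3 * del int ^+ 2 * bet int ^+ 2 * z ^+ 3.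
        have -> : 27 * k = 3%:Z ^+ 3 * k by ring.
        by rewrite -hk; ring.
      have -> : 3 * (del int * del int * (bet int * bet int) * z ^+ 3) =
        27 * k - 9 * del int * bet int * v ^+ 3 +
        9 * del int ^+ 2 * bet int * v * z ^+ 2 by rewrite hk; ring.
      by ring.
    by rewrite !Euclid_dvdzM // (negbTE ndel) (negbTE nbet) /= !orbb.
  have [z' hz'] := hdiv _ pz.
  have {}hx : inOK r (bK (0%:~R / p%:R) (v%:~R / p%:R) (0%:~R / p%:R)).
    by apply: (bK_div p 0 v 0 0 0 z' p0); rewrite -hz' !add0r (mul0r p%:Z) addr0.
  have [k hk] := normB_dvd _ _ _ _ p0 hx.
  have : (p %| del int * bet int * v ^+ 3)%Z.
    apply/dvdzP; exists k; apply: (@mulfI _ 9) => //.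
    have -> : 9 * (k * p) = p%:Z ^+ 3 * k by rewrite p3; ring.
    by rewrite -hk /normB; ring.
  by rewrite !Euclid_dvdzM // (negbTE ndel) (negbTE nbet) /= !orbb.
have p_dvd3 : ~~ (p %| 3)%Z.
  by rewrite dvdzE /= dvdn_prime2.
have pdel : (p %| del int)%Z by move: pd'; rewrite Euclid_dvdzM // (negbTE p_dvd3).
have nbet := p_bet pdel.
have [d hd] := hdiv _ pdel.
have nd : ~~ (p %| d)%Z.
  apply/negP => /hdiv [d' hd']; apply: (sqf p pp).
  have : (p%:Z ^+ 2 %| del int)%Z by rewrite hd hd' -mulrA -expr2 dvdz_mull.
  by rewrite delE dvdzE abszX.
have pv : (p %| v)%Z.
  have [k hk] := normB_dvd _ _ _ _ p0 hx.
  have : (p %| 3 * 3 * d * bet int * v ^+ 3)%Z.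
    apply/dvdzP; exists (p%:Z * k + 9 * d ^+ 2 * bet int * v * z ^+ 2
       - 3 * d ^+ 2 * bet int ^+ 2 * z ^+ 3).
    apply: (mulfI pZ).
    have e (X Y : int) : p%:Z * ((p%:Z * k + X - Y) * p) =
      p%:Z ^+ 3 * k + p%:Z ^+ 2 * X - p%:Z ^+ 2 * Y by ring.
    by rewrite e -hk /normB hd; ring.
  by rewrite !Euclid_dvdzM // (negbTE p_dvd3) (negbTE nd) (negbTE nbet) /= !orbb.
have [v' hv'] := hdiv _ pv.
have {}hx : inOK r (bK (0%:~R / p%:R) (0%:~R / p%:R) (z%:~R / p%:R)).
  by apply: (bK_div p 0 0 z 0 v' 0 p0); rewrite -hv' !add0r (mul0r p%:Z) addr0.
have [k hk] := normB_dvd _ _ _ _ p0 hx.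
have : (p %| 3 * d * d * bet int * bet int * z ^+ 3)%Z.
  apply/dvdzP; exists k; apply: (mulfI pZ); apply: (mulfI pZ).
  have -> : p%:Z * (p%:Z * (k * p)) = p%:Z ^+ 3 * k by ring.
  by rewrite -hk /normB hd; ring.
by rewrite !Euclid_dvdzM // (negbTE p_dvd3) (negbTE nd) (negbTE nbet) /= !orbb.
Qed.

(** One prime at a time: multiplication by N/p leaves the denominator p, [prime_step] divides the
    numerators by p, and N/p remains. *)
Lemma denominator_dvd (N : nat) : (0 < N)%N ->
  (forall p, prime p -> (p %| N)%N -> (p %| 3 * (3 * m ^ 2 + 3 * m + 1))%N) ->
  forall u v z : int, inOK r (bK (u%:~R / N%:R) (v%:~R / N%:R) (z%:~R / N%:R)) ->
  [/\ (N %| u)%Z, (N %| v)%Z & (N %| z)%Z].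
Proof.
elim/ltn_ind: N => N IH N0 hN u v z hx.
have [N1 | N1] := leqP N 1.
  by have -> : N = 1%N by lia.
have pp := pdiv_prime N1; set p := pdiv N in pp.
have p0 := prime_gt0 pp.
have pN : (p %| N)%N := pdiv_dvd N.
have eN : N = (N %/ p * p)%N by rewrite divnK.
set N' := (N %/ p)%N in eN.
have N'0 : (0 < N')%N by rewrite divn_gt0 // dvdn_leq.
have p0' : (p%:R : rat) != 0 by rewrite pnatr_eq0 -lt0n.
have N'0' : (N'%:R : rat) != 0 by rewrite pnatr_eq0 -lt0n.
have hx' : inOK r (bK (u%:~R / p%:R) (v%:~R / p%:R) (z%:~R / p%:R)).
  have e (x : int) : x%:~R / p%:R = N'%:R * (x%:~R / N%:R) :> rat.
    by rewrite eN natrM; field; rewrite p0' N'0'.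
  have : inOK r (scaleK N'%:R (bK (u%:~R / N%:R) (v%:~R / N%:R) (z%:~R / N%:R))).
    by rewrite /inOK emb_scale ratr_nat rpredM // rpred_nat.
  congr inOK; rewrite !e; move: (u%:~R / _) (v%:~R / _) (z%:~R / _) => U V Z.
  unlockK; rewrite /bK /=; move: M => M'.
  by congr (_, _, _); field.
have [/dvdzP [u' hu] /dvdzP [v' hv] /dvdzP [z' hz]] := prime_step p u v z pp (hN p pp pN) hx'.
have N'N : (N' < N)%N by rewrite eN -{1}(muln1 N') ltn_pmul2l // prime_gt1.
have hN' q : prime q -> (q %| N')%N -> (q %| 3 * (3 * m ^ 2 + 3 * m + 1))%N.
  by move=> pq qN; apply: hN => //; rewrite eN dvdn_mulr.
have [] := IH N' N'N N'0 hN' u' v' z'.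
  have e (x : int) : (x * p)%:~R / N%:R = x%:~R / N'%:R :> rat.
    by rewrite eN natrM; field; rewrite p0' N'0'.
  by move: hx; rewrite hu hv hz !e.
by rewrite hu hv hz eN PoszM => *; split; rewrite dvdz_mul.
Qed.

(** The traces of x, x y and x w are integers. Inverting the trace form bounds the denominator of
    the coordinates by 9 del, whose prime factors all divide 3 del. *)
Lemma inOK_intK (x : Kel) : inOK r x -> intK x.
Proof.
have [u [v [z ->]]] := bK_surj x => hx.
pose D : rat := del rat; pose b : rat := bet rat.
have [t1 h1] := traceK_int _ hx.
have yI : inOK r (bK 0 1 0) by have := bK_int 0 1 0; rewrite mulr0z mulr1z.
have wI : inOK r (bK 0 0 1) by have := bK_int 0 0 1; rewrite mulr0z mulr1z.
have [t2 h2] := traceK_int _ (inOK_mul _ _ hx yI).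
have [t3 h3] := traceK_int _ (inOK_mul _ _ hx wI).
have {}h1 : 3 * u + 6 * D * z = t1%:~R.
  rewrite -h1; unlockK; rewrite /bK /D /del aE /=; move: M => M'; by field.
have {}h2 : 18 * D * v + 9 * D * b * z = t2%:~R.
  rewrite -h2; unlockK; rewrite /bK /D /b /del /bet aE /=; move: M => M'; by field.
have {}h3 : 6 * D * u + 9 * D * b * v + 18 * D ^+ 2 * z = t3%:~R.
  rewrite -h3; unlockK; rewrite /bK /D /b /del /bet aE /=; move: M => M'; by field.
pose N := (9 * (3 * m ^ 2 + 3 * m + 1))%N.
have NE : N%:R = 9 * D by rewrite /N /D /del; ring.
have N0 : (N%:R : rat) != 0 by rewrite pnatr_eq0; rewrite /N; lia.
have rel : 4 * D - 3 * b ^+ 2 = 1 by rewrite /D /b /del /bet; ring.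
(* Cramer's rule: [e] no longer contains u, and the determinant of the system left in v and z
   collapses through 4 del - 3 bet^2 = 1. *)
pose e : int := t3 - 2 * del int * t1.
pose zi : int := 6 * e - 3 * bet int * t2.
pose vi : int := 2 * del int * t2 - 3 * bet int * e.
pose ui : int := 3 * del int * t1 - 2 * del int * zi.
have castD : (del int)%:~R = D by rewrite /D /del; ring.
have castb : (bet int)%:~R = b by rewrite /b /bet; ring.
have eE : e%:~R = t3%:~R - 2 * D * t1%:~R :> rat by rewrite -castD /e; ring.
have ziE : zi%:~R = 6 * e%:~R - 3 * b * t2%:~R :> rat by rewrite -castb /zi; ring.
have viE : vi%:~R = 2 * D * t2%:~R - 3 * b * e%:~R :> rat.
  by rewrite -castD -castb /vi; ring.
have uiE : ui%:~R = 3 * D * t1%:~R - 2 * D * zi%:~R :> rat by rewrite -castD /ui; ring.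
have ze : z = zi%:~R / N%:R.
  apply: (mulIf N0); rewrite divfK // NE ziE eE -h1 -h2 -h3.
  by rewrite -(mulr1 (z * _)) -{1}rel; clearbody D b; ring.
have ve : v = vi%:~R / N%:R.
  apply: (mulIf N0); rewrite divfK // NE viE eE -h1 -h2 -h3.
  by rewrite -(mulr1 (v * _)) -{1}rel; clearbody D b; ring.
have ue : u = ui%:~R / N%:R.
  apply: (mulIf N0); rewrite divfK // NE uiE -h1.
  have -> : zi%:~R = z * (9 * D) by rewrite ze -NE divfK.
  by clearbody D b; ring.
have [] := denominator_dvd N _ _ ui vi zi; first by rewrite /N; lia.
- move=> p pp; rewrite /N (Euclid_dvdM _ _ pp) => /orP [p9 | pd].
    rewrite Euclid_dvdM //; apply/orP; left.
    by move: p9; rewrite (_ : 9 = 3 ^ 2)%N // Euclid_dvdX // => /andP[].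
  by rewrite dvdn_mull.
- by rewrite -ue -ve -ze.
have red (t : int) : (N %| t)%Z -> exists y : int, t%:~R / N%:R = y%:~R :> rat.
  by case/dvdzP => y ->; exists y; rewrite intrM -pmulrn mulfK.
move=> /red [u' hu] /red [v' hv] /red [z' hz].
rewrite ue ve ze hu hv hz; exact: bK_gel.
Qed.

End IntegralBasis.

(** * Lattice coordinates *)

Section Lattice.
Variable m : nat.
Local Notation n := (9 * m + 3)%N.
Local Notation a := (n%:R : rat).
Local Notation M := (m%:R : rat).
Local Notation mz := (m%:Z : int).
Local Notation mulK := (mulK a).
Local Notation sgK := (sgK a).
Local Notation tpK := (tpK a).

Local Ltac Kfield :=
  unlockK; rewrite /gel /= ?aE; try congr (_, _, _); field.

(* Lattice coordinates: x = V k n1 n2 n3 with n1 + n2 + n3 = 3 m k, where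
   k = Tr (delta0 x). They are chosen so that multiplication by a unit composed
   with sgK permutes n1, n2, n3 cyclically; n2 is redundant. *)
Definition V (k n1 n2 n3 : int) : Kel :=
  gel (- k - 2 * n1)%:~R (n3 - k - 2 * n1 - (3 * mz + 1) * (2 * k + 3 * n1))%:~R
      (2 * k + 3 * n1)%:~R.

Lemma VD (k n1 n2 n3 k' n1' n2' n3' : int) :
  addK (V k n1 n2 n3) (V k' n1' n2' n3') =
  V (k + k') (n1 + n1') (n2 + n2') (n3 + n3').
Proof. by rewrite /V; Kfield. Qed.

Lemma intK_V (k n1 n2 n3 : int) : intK (V k n1 n2 n3).
Proof. by rewrite /V /intK; eexists _, _, _. Qed.

Lemma intKP (x : Kel) : intK x ->
  exists k n1 n2 n3, n1 + n2 + n3 = 3 * mz * k /\ x = V k n1 n2 n3.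
Proof.
case=> c1 [c2 [c3 ->]]; pose k := 3 * c1 + 2 * c3; pose n1 := - 2 * c1 - c3.
pose n3 := (3 * mz + 1) * c3 + c2 - c1.
exists k, n1, (3 * mz * k - n1 - n3), n3; split; first by ring.
by rewrite /V /k /n1 /n3; congr gel; ring.
Qed.

Lemma gel_inj (c1 c2 c3 d1 d2 d3 : int) :
  gel c1%:~R c2%:~R c3%:~R = gel d1%:~R d2%:~R d3%:~R ->
  [/\ c1 = d1, c2 = d2 & c3 = d3].
Proof.
rewrite /gel => -[e0 e1 e2].
by split; apply: (@intr_inj rat); lra.
Qed.

Lemma V_inj (k n1 n2 n3 k' n1' n2' n3' : int) :
  V k n1 n2 n3 = V k' n1' n2' n3' -> [/\ k = k', n1 = n1' & n3 = n3'].
Proof.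
move=> /gel_inj [e1 e2 e3].
have kk' : k = k' by lia.
have nn' : n1 = n1' by lia.
by split=> //; move: e2; rewrite kk' nn' => /addIr/addIr/addIr.
Qed.

(* rho^2 and rho^2/(1 + rho)^2 *)
Definition e2K : Kel := (0, 0, 1).
Definition e3K : Kel := (- 1 - a, - (a ^+ 2 + 3 * a + 3), a + 2).
Definition tauK (x : Kel) : Kel := mulK e3K (sgK x).

Lemma oneK_V : oneK = V 3 (-2) (9 * mz + 3) (-1).
Proof. by rewrite /V; Kfield. Qed.
Lemma e2K_V : e2K = V 3 (-1) (-2) (9 * mz + 3).
Proof. by rewrite /V /e2K; Kfield. Qed.
Lemma e3K_V : e3K = V 3 (9 * mz + 3) (-1) (-2).
Proof. by rewrite /V /e3K; Kfield. Qed.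

Lemma tauK_V (k n1 n2 n3 : int) : n1 + n2 + n3 = 3 * mz * k ->
  tauK (V k n1 n2 n3) = V k n2 n3 n1.
Proof.
move=> h; have -> : n2 = 3 * mz * k - n1 - n3 by lia.
by rewrite /tauK /V /e3K; Kfield.
Qed.

(** Closed forms of the traces against [d0K] and [d1K], that is, of the forms k and psi. *)
Definition levK (x : Kel) : rat := 3 * (x.1.1 + x.2).
Definition psiK (x : Kel) : rat := x.1.1 + 2 * x.2.

Lemma levK_V (k n1 n2 n3 : int) : levK (V k n1 n2 n3) = k%:~R.
Proof. by rewrite /levK /V /gel /=; field. Qed.

Lemma psiK_V (k n1 n2 n3 : int) : psiK (V k n1 n2 n3) = (n1 + k)%:~R.
Proof. by rewrite /psiK /V /gel /=; field. Qed.

Lemma levKD (x y : Kel) : levK (addK x y) = levK x + levK y.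
Proof. by rewrite /levK; unlockK => /=; ring. Qed.

Lemma tpK_e2K : tpK e2K.
Proof.
have -> : e2K = mulK (0, 1, 0) (0, 1, 0) by rewrite /e2K; Kfield.
by apply: (tpK_sqr _ _ (- a - 3, - a, 1)); Kfield.
Qed.

(* 1 + rho and its inverse *)
Definition eps : Kel := (1, 1, 0).
Definition ieps : Kel := (2, a + 1, -1).

Lemma eps_ieps : mulK eps ieps = oneK.
Proof. by rewrite /eps /ieps; Kfield. Qed.

Lemma tpK_eps2 : tpK (mulK eps eps).
Proof. exact: tpK_sqr eps_ieps. Qed.

Lemma tpK_ieps2 : tpK (mulK ieps ieps).
Proof. by apply: tpK_sqr; rewrite mulKC; exact: eps_ieps. Qed.

Lemma e3KE : e3K = mulK e2K (mulK ieps ieps).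
Proof. by rewrite /e3K /e2K /ieps; Kfield. Qed.

Lemma tpK_e3K : tpK e3K.
Proof. rewrite e3KE; apply: tpK_mul tpK_e2K tpK_ieps2. Qed.

Lemma tpK_tauK (x : Kel) : tpK x -> tpK (tauK x).
Proof. by move=> hx; apply: tpK_mul tpK_e3K _; apply: tpK_sgK. Qed.

Definition g3K : Kel := gel 0 0 1.

Lemma g3K_V : g3K = V 2 (-1) (3 * mz) (3 * mz + 1).
Proof. by rewrite /g3K /V; Kfield. Qed.

(** g3 lies outside the cone on 1, rho^2, e3, but in the middle of the adjacent one on 1, rho^2, (1
    + rho)^2; this gives its total positivity. *)
Lemma g3K_cone : scaleK 6 g3K = addK oneK (addK e2K (mulK eps eps)).
Proof. by rewrite /g3K /e2K /eps; Kfield. Qed.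

Lemma tpK_g3K : tpK g3K.
Proof.
have : tpK (scaleK 6 g3K).
  by rewrite g3K_cone; apply: tpK_add (tpK_one _) (tpK_add _ _ _ tpK_e2K tpK_eps2).
by move=> h r hr; move: (h r hr); rewrite emb_scale pmulr_rgt0 // ltr0q.
Qed.

(* With u_i = 3 n_i + k, the cone spanned by 1, e2K, e3K is cut out by the
   nonnegativity of facet u1 u2 u3 and of its two cyclic shifts. *)
Definition facet (x y z : int) : int := (9 * mz + 4) ^+ 2 * x + (9 * mz + 4) * y + z.

(** With q = 9m + 4, the vertices 1, rho^2, e3 have (u1, u2, u3) equal to (-3, 3q, 0), (0, -3, 3q),
    (3q, 0, -3). The form q^2 u1 + q u2 + u3 vanishes at the first two and equals 3 (q^3 - 1) at the
    third. *)
Lemma cone_eq (k n1 n2 n3 : int) : n1 + n2 + n3 = 3 * mz * k ->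
  let u1 := 3 * n1 + k in let u2 := 3 * n2 + k in let u3 := 3 * n3 + k in
  scaleK (3 * ((9 * M + 4) ^+ 3 - 1)) (V k n1 n2 n3) =
  addK (scaleK (facet u2 u3 u1)%:~R oneK)
    (addK (scaleK (facet u3 u1 u2)%:~R e2K) (scaleK (facet u1 u2 u3)%:~R e3K)).
Proof.
move=> h /=; have -> : n2 = 3 * mz * k - n1 - n3 by lia.
by rewrite /V /facet /e2K /e3K; Kfield.
Qed.

Lemma facet_sum (k n1 n2 n3 : int) : n1 + n2 + n3 = 3 * mz * k ->
  let u1 := 3 * n1 + k in let u2 := 3 * n2 + k in let u3 := 3 * n3 + k in
  facet u2 u3 u1 + facet u3 u1 u2 + facet u1 u2 u3 = ((9 * mz + 4) ^+ 3 - 1) * k.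
Proof.
move=> h /=; have -> : n2 = 3 * mz * k - n1 - n3 by lia.
by rewrite /facet; ring.
Qed.

Lemma tpK_cone (k n1 n2 n3 : int) : n1 + n2 + n3 = 3 * mz * k -> 0 < k ->
  0 <= facet (3 * n1 + k) (3 * n2 + k) (3 * n3 + k) ->
  0 <= facet (3 * n2 + k) (3 * n3 + k) (3 * n1 + k) ->
  0 <= facet (3 * n3 + k) (3 * n1 + k) (3 * n2 + k) ->
  tpK (V k n1 n2 n3).
Proof.
move=> h k0 f1 f2 f3 r hr.
have := congr1 (emb r) (cone_eq k n1 n2 n3 h).
have := facet_sum k n1 n2 n3 h; move: f1 f2 f3 => /=.
set F1 := facet (3 * n2 + k) _ _; set F2 := facet (3 * n3 + k) _ _.
set F3 := facet (3 * n1 + k) _ _; move: F1 F2 F3 => F1 F2 F3 f3 f1 f2 fs.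
rewrite emb_scale !emb_add !emb_scale !ratr_int => he.
have d0 : 0 < ratr (3 * ((9 * M + 4) ^+ 3 - 1)) :> algC.
  rewrite ltr0q; have := ler0n rat m; move: M => M' M'0.
  have M2 : 0 <= M' ^+ 2 by rewrite exprn_ge0.
  have M3 : 0 <= M' ^+ 3 by rewrite exprn_ge0.
  by lra.
rewrite -(pmulr_rgt0 _ d0) he.
have E1 : 0 < emb r oneK by apply: tpK_one hr.
have E2 := tpK_e2K r hr; have E3 := tpK_e3K r hr.
have : [|| 0 < F1, 0 < F2 | 0 < F3].
  by nia.
have i1 : (0 : algC) <= F1%:~R by rewrite ler0z.
have i2 : (0 : algC) <= F2%:~R by rewrite ler0z.
have i3 : (0 : algC) <= F3%:~R by rewrite ler0z.
have p1 : 0 <= F1%:~R * emb r oneK by rewrite mulr_ge0 // ltW.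
have p2 : 0 <= F2%:~R * emb r e2K by rewrite mulr_ge0 // ltW.
have p3 : 0 <= F3%:~R * emb r e3K by rewrite mulr_ge0 // ltW.
case/or3P => F0.
- by rewrite ltr_wpDr ?addr_ge0 // mulr_gt0 ?ltr0z.
- by rewrite ltr_wpDl // ltr_wpDr // mulr_gt0 ?ltr0z.
- by rewrite ltr_wpDl // ltr_wpDl // mulr_gt0 ?ltr0z.
Qed.

End Lattice.

(** * The listed elements *)

Section Lists.
Variable m : nat.
Local Notation n := (9 * m + 3)%N.
Local Notation M := (m%:R : rat).
Local Notation mz := (m%:Z : int).
Local Notation V := (V m).

Lemma nrE : nr n = 9 * M + 3. Proof. by rewrite /nr natrD natrM. Qed.

Local Ltac gelV := rewrite /V ?nrE /nr /gel; congr (_, _, _); field.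

Lemma gel_vV (v t : nat) :
  gel (- (2 * nr v + 1)) (- (nr v * (nr n + 3) + nr t + 1)) (3 * nr v + 2) =
  V 1 v (t%:Z - 3 * mz - 2) (6 * mz + 2 - v%:Z - t%:Z).
Proof. by gelV. Qed.

Lemma gel_viV (t : nat) :
  gel 0 (- (nr t + 1)) 1 = V 2 (-1) (3 * mz + 1 + t%:Z) (3 * mz - t%:Z).
Proof. by gelV. Qed.

Lemma gel_viiV (v : nat) :
  gel (- (2 * nr v + 2)) (- (nr v * (nr n + 3) + 2 * nr n / 3 + 3)) (3 * nr v + 4) =
  V 2 v (-1) (6 * mz + 1 - v%:Z).
Proof. by gelV. Qed.

Lemma gel_viiiV (v : nat) :
  gel (- (2 * nr v + 2)) (- (nr v * (nr n + 3) + 4 * nr n / 3 - nr v + 3)) (3 * nr v + 4) =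
  V 2 v (6 * mz + 1 - v%:Z) (-1).
Proof. by gelV. Qed.

Lemma gel_iiV (t : nat) :
  gel (-1) (- (nr t + 1)) 3 = V 3 (-1) (t%:Z - 2) (9 * mz + 3 - t%:Z).
Proof. by gelV. Qed.

Lemma gel_iiiV (v : nat) :
  gel (- (2 * nr v + 1)) (- (nr v * (nr n + 3) + 2)) (3 * (nr v + 1)) =
  V 3 (v%:Z - 1) (-1) (9 * mz + 2 - v%:Z).
Proof. by gelV. Qed.

Lemma gel_ivV (v : nat) :
  gel (- (2 * nr v + 1)) (- ((nr v + 1) * (nr n + 2))) (3 * (nr v + 1)) =
  V 3 (v%:Z - 1) (9 * mz + 2 - v%:Z) (-1).
Proof. by gelV. Qed.

Lemma mem_list_v (c : Kel) : reflect
  (exists n1 n2 n3 : int, [/\ n1 + n2 + n3 = 3 * mz * 1, 0 <= n1, 0 <= n2, 0 <= n3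
     & c = V 1 n1 n2 n3]) (c \in list_v n).
Proof.
apply: (iffP mapP) => [[[v t]] | [n1 [n2 [n3 [h h1 h2 h3 ->]]]]].
  rewrite mem_filter /= => /andP[/andP[/andP[c1 c2] c3] _] ->.
  exists v%:Z, (t%:Z - 3 * mz - 2), (6 * mz + 2 - v%:Z - t%:Z).
  by split; try lia; exact: gel_vV.
exists (absz n1, absz (n2 + 3 * mz + 2)).
  rewrite mem_filter; apply/andP; split; first by rewrite /=; lia.
  by apply: (allpairs_f pair); rewrite mem_iota; lia.
by rewrite /= gel_vV; congr V; lia.
Qed.

(** The bound on [n2] leaves out n2 = 3m, which is g3. The same parameters describe (vii) and
    (viii), with the coordinates rotated. *)
Lemma mem_list_vi (c : Kel) : reflect
  (exists n2 n3 : int, [/\ -1 + n2 + n3 = 3 * mz * 2, 3 * mz + 1 <= n2, 0 <= n3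
     & c = V 2 (-1) n2 n3]) (c \in list_vi n).
Proof.
apply: (iffP mapP) => [[t] | [n2 [n3 [h h2 h3 ->]]]].
  rewrite mem_filter /= => /andP[c1 _] ->.
  by exists (3 * mz + 1 + t%:Z), (3 * mz - t%:Z); split; try lia; exact: gel_viV.
exists (absz (n2 - 3 * mz - 1)%R); first by rewrite mem_filter mem_iota /=; lia.
by rewrite gel_viV; congr V; lia.
Qed.

Lemma mem_list_vii (c : Kel) : reflect
  (exists n2 n3 : int, [/\ -1 + n2 + n3 = 3 * mz * 2, 3 * mz + 1 <= n2, 0 <= n3
     & c = V 2 n3 (-1) n2]) (c \in list_vii n).
Proof.
apply: (iffP mapP) => [[v] | [n2 [n3 [h h2 h3 ->]]]].
  rewrite mem_filter /= => /andP[c1 _] ->.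
  by exists (6 * mz + 1 - v%:Z), v%:Z; split; try lia; exact: gel_viiV.
exists (absz n3); first by rewrite mem_filter mem_iota /=; lia.
by rewrite gel_viiV; congr V; lia.
Qed.

Lemma mem_list_viii (c : Kel) : reflect
  (exists n2 n3 : int, [/\ -1 + n2 + n3 = 3 * mz * 2, 3 * mz + 1 <= n2, 0 <= n3
     & c = V 2 n2 n3 (-1)]) (c \in list_viii n).
Proof.
apply: (iffP mapP) => [[v] | [n2 [n3 [h h2 h3 ->]]]].
  rewrite mem_filter /= => /andP[/andP[c1 c2] _] ->.
  by exists v%:Z, (6 * mz + 1 - v%:Z); split; try lia; exact: gel_viiiV.
exists (absz n2); first by rewrite mem_filter mem_iota /=; lia.
by rewrite gel_viiiV; congr V; lia.
Qed.

Lemma mem_list_ii (c : Kel) : reflect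
  (exists n2 n3 : int, [/\ -1 + n2 + n3 = 3 * mz * 3, -1 <= n2 <= 3 * mz - 1
     & c = V 3 (-1) n2 n3]) (c \in list_ii n).
Proof.
apply: (iffP mapP) => [[t] | [n2 [n3 [h /andP[h2 h3] ->]]]].
  rewrite mem_filter /= => /andP[/andP[c1 c2] _] ->.
  by exists (t%:Z - 2), (9 * mz + 3 - t%:Z); split; try lia; exact: gel_iiV.
exists (absz (n2 + 2)%R); first by rewrite mem_filter mem_iota /=; lia.
by rewrite gel_iiV; congr V; lia.
Qed.

Lemma mem_list_iii (c : Kel) : reflect
  (exists n2 n3 : int, [/\ -1 + n2 + n3 = 3 * mz * 3, -1 <= n2 <= 3 * mz - 1
     & c = V 3 n3 (-1) n2]) (c \in list_iii n).
Proof.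
apply: (iffP mapP) => [[v] | [n2 [n3 [h /andP[h2 h3] ->]]]].
  rewrite mem_filter /= => /andP[/andP[c1 c2] _] ->.
  by exists (9 * mz + 2 - v%:Z), (v%:Z - 1); split; try lia; exact: gel_iiiV.
exists (absz (n3 + 1)%R); first by rewrite mem_filter mem_iota /=; lia.
by rewrite gel_iiiV; congr V; lia.
Qed.

Lemma mem_list_iv (c : Kel) : reflect
  (exists n2 n3 : int, [/\ -1 + n2 + n3 = 3 * mz * 3, -1 <= n2 <= 3 * mz - 1
     & c = V 3 n2 n3 (-1)]) (c \in list_iv n).
Proof.
apply: (iffP mapP) => [[v] | [n2 [n3 [h /andP[h2 h3] ->]]]].
  rewrite mem_filter /= => /andP[c1 _] ->.
  by exists (v%:Z - 1), (9 * mz + 2 - v%:Z); split; try lia; exact: gel_ivV.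
exists (absz (n2 + 1)%R); first by rewrite mem_filter mem_iota /=; lia.
by rewrite gel_ivV; congr V; lia.
Qed.

Lemma mem_list_i (c : Kel) : reflect (c = g3K) (c \in list_i n).
Proof. by rewrite /list_i mem_seq1; apply: eqP. Qed.

Lemma uniq_list_v : uniq (list_v n).
Proof.
rewrite map_inj_uniq.
  by rewrite filter_uniq // allpairs_uniq ?iota_uniq // => -[? ?] [? ?].
move=> [v t] [v' t'] /=; rewrite !gel_vV => /V_inj [_ e1 e2].
by congr pair; lia.
Qed.

Lemma uniq_list_vi : uniq (list_vi n).
Proof.
rewrite map_inj_uniq ?filter_uniq ?iota_uniq // => t t'.
by rewrite !gel_viV => /V_inj [_ _ e]; lia.
Qed.

Lemma uniq_list_vii : uniq (list_vii n).
Proof.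
rewrite map_inj_uniq ?filter_uniq ?iota_uniq // => t t'.
by rewrite !gel_viiV => /V_inj [_ e _]; lia.
Qed.

Lemma uniq_list_viii : uniq (list_viii n).
Proof.
rewrite map_inj_uniq ?filter_uniq ?iota_uniq // => t t'.
by rewrite !gel_viiiV => /V_inj [_ e _]; lia.
Qed.

Lemma uniq_list_ii : uniq (list_ii n).
Proof.
rewrite map_inj_uniq ?filter_uniq ?iota_uniq // => t t'.
by rewrite !gel_iiV => /V_inj [_ _ e]; lia.
Qed.

Lemma uniq_list_iii : uniq (list_iii n).
Proof.
rewrite map_inj_uniq ?filter_uniq ?iota_uniq // => t t'.
by rewrite !gel_iiiV => /V_inj [_ e _]; lia.
Qed.

Lemma uniq_list_iv : uniq (list_iv n).
Proof.
rewrite map_inj_uniq ?filter_uniq ?iota_uniq // => t t'.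
by rewrite !gel_ivV => /V_inj [_ e _]; lia.
Qed.

Lemma gel1_V : gel 1 0 0 = V 3 (-2) (9 * mz + 3) (-1).
Proof. by gelV. Qed.

Lemma uniq_cat_disjoint (T : eqType) (s t : seq T) : uniq s -> uniq t ->
  (forall c, c \in s -> c \in t -> False) -> uniq (s ++ t).
Proof.
move=> us ut st; rewrite cat_uniq us ut andbT; apply/hasPn => c ct.
by apply/negP => /= cs; exact: st cs ct.
Qed.

Local Ltac list_form H :=
  lazymatch type of H with
  | is_true (_ \in _ ++ _) => move: H; rewrite mem_cat => /orP[] H; list_form H
  | is_true (_ \in list_i _) => move/mem_list_i: H; rewrite ?(g3K_V m) => H
  | is_true (_ \in list_v _) => move/mem_list_v: H => [? [? [? [? ? ? ? H]]]]
  | is_true (_ \in list_vi _) => move/mem_list_vi: H => [? [? [? ? ? H]]]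
  | is_true (_ \in list_vii _) => move/mem_list_vii: H => [? [? [? ? ? H]]]
  | is_true (_ \in list_viii _) => move/mem_list_viii: H => [? [? [? ? ? H]]]
  | is_true (_ \in list_ii _) => move/mem_list_ii: H => [? [? [? /andP[? ?] H]]]
  | is_true (_ \in list_iii _) => move/mem_list_iii: H => [? [? [? /andP[? ?] H]]]
  | is_true (_ \in list_iv _) => move/mem_list_iv: H => [? [? [? /andP[? ?] H]]]
  end.

Local Ltac lists_disjoint :=
  let c := fresh "c" in let h1 := fresh "h" in let h2 := fresh "h" in
  move=> c h1 h2; list_form h1; list_form h2; subst c;
  move/V_inj: h2 => [? ? ?]; lia.

Lemma uniq_indec_list : (0 < m)%N -> uniq (indec_list n).
Proof.
move=> m0; rewrite /indec_list cons_uniq /list_tr1 /list_tr2; apply/andP; split.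
  apply/negP => h; list_form h; move: h; rewrite gel1_V => /V_inj [? ? ?]; lia.
apply: uniq_cat_disjoint; last by lists_disjoint.
  apply: uniq_cat_disjoint => //; last by lists_disjoint.
  apply: uniq_cat_disjoint; [exact: uniq_list_v | | by lists_disjoint].
  apply: uniq_cat_disjoint; [exact: uniq_list_vi | | by lists_disjoint].
  apply: uniq_cat_disjoint; [exact: uniq_list_vii | exact: uniq_list_viii | by lists_disjoint].
apply: uniq_cat_disjoint; [exact: uniq_list_ii | | by lists_disjoint].
apply: uniq_cat_disjoint; [exact: uniq_list_iii | exact: uniq_list_iv | by lists_disjoint].
Qed.

Lemma count_iota_range (lo hi N : nat) :
  count (fun x => (lo <= x) && (x < hi))%N (iota 0 N) = (minn hi N - minn lo N)%N.
Proof.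
elim: N => [|N IH]; first by rewrite /= !minn0.
rewrite -addn1 iotaD count_cat IH /= add0n addn0.
by case: (leqP lo N) => h1; case: (ltnP N hi) => h2 /=; lia.
Qed.

Lemma size_range_list (P : pred nat) (f : nat -> Kel) (lo hi : nat) :
  (lo <= hi <= n.+1)%N -> (forall x, (x < n.+1)%N -> P x = (lo <= x < hi)%N) ->
  size [seq f v | v <- [seq v <- rng n | P v]] = (hi - lo)%N.
Proof.
move=> /andP[h1 h2] hP; rewrite size_map size_filter /rng.
rewrite (@eq_in_count _ _ (fun x => (lo <= x) && (x < hi))%N) ?count_iota_range; first lia.
by move=> x; rewrite mem_iota => /andP[_ hx]; exact: hP.
Qed.

Lemma size_filter_allpairs (T U : Type) (P : pred (T * U)) (s : seq T) (t : seq U) :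
  size [seq q <- allpairs pair s t | P q] =
  sumn [seq count (fun y => P (x, y)) t | x <- s].
Proof.
by elim: s => //= x s IH; rewrite filter_cat size_cat IH size_filter count_map.
Qed.

(** Family (v) is a triangle with rows of length K - v. The second summand is the part not yet
    counted; truncated subtraction makes it vanish once N >= K. *)
Lemma sumn_staircase (K N : nat) :
  (2 * sumn [seq (K - v)%N | v <- iota 0 N] + (K - N) * (K - N + 1) = K * (K + 1))%N.
Proof.
elim: N => [|N IH]; first by rewrite subn0.
rewrite -IH -[N.+1]addn1 iotaD map_cat sumn_cat /= add0n addn0.
move: (sumn _) => S; have [h | h] := leqP K N.
  have -> : (K - (N + 1) = 0)%N by lia.
  have -> : (K - N = 0)%N by lia.
  by lia.
have -> : (K - N = (K - (N + 1)).+1)%N by lia.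
by move: (K - (N + 1))%N => d; nia.
Qed.

Lemma size_list_v : (2 * size (list_v n) = (3 * m + 1) * (3 * m + 2))%N.
Proof.
rewrite size_map size_filter_allpairs.
rewrite (_ : [seq _ | x <- rng n] = [seq (3 * m + 1 - x)%N | x <- iota 0 n.+1]).
  by have := sumn_staircase (3 * m + 1) n.+1; lia.
apply/eq_in_map => v; rewrite mem_iota => /andP[_ hv].
have [h | h] := leqP (3 * v + 3) n; last first.
  rewrite (eq_count (a2 := pred0)) ?count_pred0 => [|x]; last by rewrite /=; lia.
  by lia.
transitivity (count (fun x => (3 * m + 2 <= x) && (x < 6 * m + 3 - v))%N (iota 0 n.+1)).
  by apply: eq_in_count => x _ /=; lia.
by rewrite count_iota_range; lia.
Qed.

Lemma size_indec_list : (size (indec_list n))%:R =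
  (n ^ 2 + 3 * n)%:R / 18 + 2 * n%:R + 2 :> rat.
Proof.
have hv := congr1 (fun k : nat => k%:R : rat) size_list_v.
rewrite /= !size_cat.
rewrite (size_range_list _ _ 0 (3 * m + 1)); [| lia | by move=> x _; lia].
rewrite (size_range_list _ _ 0 (3 * m + 1)); [| lia | by move=> x _; lia].
rewrite (size_range_list _ _ (3 * m + 1) (6 * m + 2)); [| lia | by move=> x _; lia].
rewrite (size_range_list _ _ 1 (3 * m + 2)); [| lia | by move=> x _; lia].
rewrite (size_range_list _ _ (6 * m + 3) (9 * m + 4)); [| lia | by move=> x _; lia].
rewrite (size_range_list _ _ 0 (3 * m + 1)); [| lia | by move=> x _; lia].
move: hv; move: (size (list_v n)) => S hv.
have -> : ((1 + (S + (3 * m + 1 - 0 + (3 * m + 1 - 0 + (6 * m + 2 - (3 * m + 1)))))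
  + (3 * m + 2 - 1 + (9 * m + 4 - (6 * m + 3) + (3 * m + 1 - 0)))).+1 = S + 18 * m + 8)%N by lia.
have -> : (n ^ 2 + 3 * n = 81 * (m * m) + 81 * m + 18)%N by nia.
have -> : (S + 18 * m + 8)%:R = S%:R + 18 * M + 8 by ring.
have -> : (81 * (m * m) + 81 * m + 18)%:R = 81 * (M * M) + 81 * M + 18 by ring.
have hS : 2 * S%:R = (3 * M + 1) * (3 * M + 2).
  transitivity ((2 * S)%:R : rat); first by ring.
  by rewrite hv; ring.
rewrite aE; move: hS; move: M (S%:R) => x y; lra.
Qed.

End Lists.

(** * Units, traces and decompositions *)

Lemma prod3_superadd (R : numDomainType) (y1 y2 y3 z1 z2 z3 : R) :
  0 < y1 -> 0 < y2 -> 0 < y3 -> 0 < z1 -> 0 < z2 -> 0 < z3 ->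
  y1 * (y2 * y3) + z1 * (z2 * z3) < (y1 + z1) * ((y2 + z2) * (y3 + z3)).
Proof.
move=> y10 y20 y30 z10 z20 z30; rewrite -subr_gt0.
have -> : (y1 + z1) * ((y2 + z2) * (y3 + z3)) - (y1 * (y2 * y3) + z1 * (z2 * z3)) =
  y1 * (y2 * z3) + y1 * (z2 * y3) + y1 * (z2 * z3) + z1 * (y2 * y3)
  + z1 * (y2 * z3) + z1 * (z2 * y3) by ring.
by rewrite !addr_gt0 ?mulr_gt0.
Qed.

(** Here l1, l2, l3 are the levels of a unit times the three vertices, x1, x2, x3 the cone
    coefficients up to scaling, k and L the levels before and after multiplication, and c = 3.
    Subtracting the two balances leaves a sum of nonnegative terms. *)
Lemma weighted_min (R : realFieldType) (D k L x1 x2 x3 l1 l2 l3 c : R) :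
  0 < D -> 0 < x1 -> 0 < x2 -> 0 < x3 -> c <= l1 -> c <= l2 -> c <= l3 ->
  x1 + x2 + x3 = D * k -> c * D * L = x1 * l1 + (x2 * l2 + x3 * l3) -> 0 < c ->
  k <= L /\ (L = k -> [/\ l1 = c, l2 = c & l3 = c]).
Proof.
move=> D0 x10 x20 x30 h1 h2 h3 fs eq c0.
have g1 : 0 <= x1 * (l1 - c) by rewrite mulr_ge0 ?subr_ge0 // ltW.
have g2 : 0 <= x2 * (l2 - c) by rewrite mulr_ge0 ?subr_ge0 // ltW.
have g3 : 0 <= x3 * (l3 - c) by rewrite mulr_ge0 ?subr_ge0 // ltW.
have e : c * D * (L - k) = x1 * (l1 - c) + x2 * (l2 - c) + x3 * (l3 - c).
  by rewrite mulrBr eq -(mulrA c D k) -fs; ring.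
split.
  by rewrite -subr_ge0 -(pmulr_rge0 _ (mulr_gt0 c0 D0)) e !addr_ge0.
move=> Lk; rewrite Lk subrr mulr0 in e.
have z (x l : R) : 0 < x -> x * (l - c) = 0 -> l = c.
  by move=> x0 /eqP; rewrite mulf_eq0 gt_eqF //= subr_eq0 => /eqP.
by split; [apply: (z x1) | apply: (z x2) | apply: (z x3)] => //; lra.
Qed.

Lemma quadratic_neq3 (R : realFieldType) (x y z : nat) (t : R) :
  (3 < x)%N -> 0 <= t -> 3 = x%:R + y%:R * t + z%:R * (t * t) -> False.
Proof.
move=> x3 t0 e; have yt := mulr_ge0 (ler0n R y) t0.
have ztt := mulr_ge0 (ler0n R z) (mulr_ge0 t0 t0).
have : (3 : R) < x%:R by rewrite ltr_nat.
by rewrite [X in X < _]e -addrA gtrDl ltNge addr_ge0.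
Qed.

Section Traces.
Variable m : nat.
Local Notation n := (9 * m + 3)%N.
Local Notation a := (n%:R : rat).
Local Notation M := (m%:R : rat).
Local Notation mz := (m%:Z : int).
Local Notation mulK := (mulK a).
Local Notation sgK := (sgK a).
Local Notation tpK := (tpK a).
Local Notation traceK := (traceK a).
Local Notation normK := (normK a).
Local Notation tauK := (tauK m).
Local Notation V := (V m).

Local Ltac Kfield :=
  unlockK; rewrite /gel /= ?aE; try congr (_, _, _); field.

(* d0K = 3 (rho + 1)^2 / (1 + rho + rho^2)^2 and
   d1K = (2 rho + 1) (rho + 1) / (1 + rho + rho^2)^2. *)
Definition d0K : Kel :=
  scaleK (9 * (3 * M ^+ 2 + 3 * M + 1))^-1
    (81 * M ^+ 2 + 90 * M + 28, 81 * M ^+ 2 + 72 * M + 16, - 5 - 9 * M).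
Definition d1K : Kel :=
  scaleK (9 * (3 * M ^+ 2 + 3 * M + 1))^-1
    (27 * M ^+ 2 + 27 * M + 7, 27 * M ^+ 2 + 18 * M + 3, - 1 - 3 * M).

Lemma del_neq0 : 3 * M ^+ 2 + 3 * M + 1 != 0.
Proof.
have := ler0n rat m; move: M => x x0; have x2 : 0 <= x ^+ 2 by rewrite exprn_ge0.
by apply: lt0r_neq0; lra.
Qed.

Lemma traceK_d0K (x : Kel) : traceK (mulK d0K x) = levK x.
Proof.
have := del_neq0; rewrite /d0K /levK; unlockK; rewrite /= aE; move: M => x0 h.
by field.
Qed.

Lemma traceK_d1K (x : Kel) : traceK (mulK d1K x) = psiK x.
Proof.
have := del_neq0; rewrite /d1K /psiK; unlockK; rewrite /= aE; move: M => x0 h.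
by field.
Qed.

Lemma tpK_sqr_quotient (d s p : Kel) : mulK d (mulK s s) = p -> tpK p -> tpK d.
Proof.
move=> e hp r hr; have := hp r hr; rewrite -e !emb_mul // -expr2 => h.
have s0 : 0 <= emb r s ^+ 2 by rewrite real_exprn_even_ge0 ?(emb_real a).
have {}s0 : 0 < emb r s ^+ 2.
  by rewrite lt0r s0 andbT; apply: contraTneq h => ->; rewrite mulr0 ltxx.
by rewrite -(pmulr_lgt0 _ s0).
Qed.

Lemma tpK_d0K : tpK d0K.
Proof.
apply: (tpK_sqr_quotient _ (1, 1, 1) (scaleK 3 (mulK eps eps))).
  have := del_neq0; rewrite /d0K /eps; unlockK; rewrite /= aE; move: M => x0 h.
  by congr (_, _, _); field.
by apply: tpK_scale => //; exact: tpK_eps2.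
Qed.

(* (2 r + 1) (r + 1) > 0 because the defining cubic is positive on [-1, -1/2]. *)
Lemma root_not_middle (r : algC) : isroot a r -> 0 < (2 * r + 1) * (r + 1).
Proof.
move=> hr; have rR := isroot_real _ _ hr.
(* Passage to the real closed field [algR], where the order is total and [nra] applies. *)
pose t : algR := in_algR rR.
have ht : t ^+ 3 = n%:R * t ^+ 2 + (n%:R + 3) * t + 1.
  apply: (fmorph_inj algRval).
  rewrite !(rmorph_nat, rmorph1, rmorphD, rmorphM, rmorphXn) /=.
  by rewrite -[RHS](_ : r ^+ 3 = _) // hr ratr_nat; ring.
suff : 0 < (2 * t + 1) * (t + 1).
  by [].
rewrite ltNge; apply/negP => le0.
have t1 : -1 <= t by nra.
have t2 : 2 * t <= -1 by nra.
have n0 : 0 <= (n%:R : algR) by exact: ler0n.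
(* The cubic is n (-t) (t + 1) + (t^3 - t) + (-2t - 1): three nonnegative terms, the last two
   without a common zero. *)
have h1 : 0 <= (- t) * (t + 1) by nra.
have h2 : 0 <= n%:R * ((- t) * (t + 1)) by rewrite mulr_ge0.
have h3 : 0 <= (- t) * (1 - t) * (t + 1) by nra.
nra.
Qed.
Lemma tpK_d1K : tpK d1K.
Proof.
apply: (tpK_sqr_quotient _ (1, 1, 1) (mulK (1, 2, 0) (1, 1, 0))).
  have := del_neq0; rewrite /d1K; unlockK; rewrite /= aE; move: M => x0 h.
  by congr (_, _, _); field.
move=> r hr; have := root_not_middle r hr; congr (_ < _).
by rewrite emb_mul // /emb /= rmorph0 rmorph1 ratr_nat; ring.
Qed.

Variable r : algC.
Hypothesis hr : isroot a r.
Hypothesis sqf : squarefree (3 * m ^ 2 + 3 * m + 1).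
Hypothesis m3 : ~~ (3 %| 2 * m + 1)%N.

Let inOKP (x : Kel) : inOK r x <-> intK x.
Proof. by split; [exact: inOK_intK hr sqf m3 _ | exact: intK_inOK hr _]. Qed.

Let hr1 : isroot a (conjr r). Proof. exact: isroot_conjr. Qed.
Let hr2 : isroot a (conjr (conjr r)). Proof. exact: isroot_conjr. Qed.

Lemma intK_one : intK oneK. Proof. by rewrite (oneK_V m); exact: intK_V. Qed.

Lemma intKM (x y : Kel) : intK x -> intK y -> intK (mulK x y).
Proof. by rewrite -!inOKP; exact: inOK_mul. Qed.

Lemma intK_sgK (x : Kel) : intK x -> intK (sgK x).
Proof.
by rewrite -!inOKP /inOK emb_sgK // => hx; apply: Aint_conj hx; [exact: hr | exact: hr1].
Qed.

Lemma intK_tauK (x : Kel) : intK x -> intK (tauK x).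
Proof.
by move=> hx; apply: intKM; [rewrite e3K_V; exact: intK_V | exact: intK_sgK].
Qed.

Lemma tpK_traceK_gt0 (x : Kel) : tpK x -> 0 < traceK x.
Proof.
move=> hx; rewrite -(ltr0q algC) (emb_traceK _ _ _ hr).
exact: addr_gt0 (addr_gt0 (hx _ hr) (hx _ hr1)) (hx _ hr2).
Qed.

Lemma tpK_normK_gt0 (x : Kel) : tpK x -> 0 < normK x.
Proof.
move=> hx; rewrite -(ltr0q algC) (emb_normK _ _ _ hr).
exact: mulr_gt0 (hx _ hr) (mulr_gt0 (hx _ hr1) (hx _ hr2)).
Qed.

Lemma intK_normK_ge1 (x : Kel) : intK x -> tpK x -> 1 <= normK x.
Proof.
move=> hx hp; have [z hz] := normK_int m r hr x ((inOKP x).2 hx).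
by have := tpK_normK_gt0 _ hp; rewrite hz ltr0z -[1]/(1%:~R) ler_int.
Qed.

(** psi is n1 + k; evaluating it at tau x and tau^2 x gives the two other bounds. *)
Lemma levK_V_ge1 (k n1 n2 n3 : int) : n1 + n2 + n3 = 3 * mz * k ->
  tpK (V k n1 n2 n3) -> [/\ 1 <= k, 1 <= n1 + k, 1 <= n2 + k & 1 <= n3 + k].
Proof.
have psi k' n1' n2' n3' : tpK (V k' n1' n2' n3') -> 1 <= n1' + k'.
  move=> h; have := tpK_traceK_gt0 _ (tpK_mul _ _ _ tpK_d1K h).
  by rewrite traceK_d1K psiK_V ltr0z.
move=> h0 h; have h1 := tpK_tauK m _ h; rewrite tauK_V // in h1.
have h0' : n2 + n3 + n1 = 3 * mz * k by lia.
have h2 := tpK_tauK m _ h1; rewrite tauK_V // in h2.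
split; [| exact: psi h | exact: psi h1 | exact: psi h2].
have := tpK_traceK_gt0 _ (tpK_mul _ _ _ tpK_d0K h).
by rewrite traceK_d0K levK_V ltr0z.
Qed.

Definition unitK (e : Kel) : Prop :=
  [/\ intK e, tpK e & exists2 f, intK f & mulK e f = oneK].

Lemma unitK_inv (e : Kel) : unitK e -> exists2 f, unitK f & mulK e f = oneK.
Proof.
case=> ie pe [f jf ef]; exists f => //; split=> //; last first.
  by exists e => //; rewrite mulKC.
move=> s hs; have := emb_one s; rewrite -ef emb_mul // => h.
by rewrite -(pmulr_rgt0 _ (pe s hs)) h ltr01.
Qed.

Lemma unitKM (e f : Kel) : unitK e -> unitK f -> unitK (mulK e f).
Proof.
case=> ie pe [e' ie' ee'] [jf pf [f' jf' ff']]; split.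
- exact: intKM.
- exact: tpK_mul.
exists (mulK f' e'); first exact: intKM.
by rewrite -mulKA (mulKA _ f) ff' mul1K.
Qed.

Lemma sgK_one : sgK oneK = oneK. Proof. by Kfield. Qed.

Lemma unitK_sgK (e : Kel) : unitK e -> unitK (sgK e).
Proof.
case=> ie pe [e' ie' ee']; split.
- exact: intK_sgK.
- exact: tpK_sgK.
by exists (sgK e'); [exact: intK_sgK | rewrite -sgKM ee' sgK_one].
Qed.

Lemma intK_power (c0 c1 c2 : int) : intK (c0%:~R, c1%:~R, c2%:~R).
Proof.
by exists (c0 - c2), (c1 - c2), (3 * c2); rewrite /gel; congr (_, _, _); field.
Qed.

Lemma unitK_one : unitK oneK.
Proof.
split; [exact: intK_one | exact: tpK_one | exists oneK; first exact: intK_one].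
by rewrite mul1K.
Qed.

Lemma unitK_sqr (x y : Kel) : intK x -> intK y -> mulK x y = oneK ->
  unitK (mulK x x) /\ unitK (mulK y y).
Proof.
move=> ix iy xy; have yx : mulK y x = oneK by rewrite mulKC.
have e : mulK (mulK x x) (mulK y y) = oneK.
  by rewrite -(mulKA a x x) (mulKA a x y y) xy mul1K.
split; split; try by [apply: intKM | apply: tpK_sqr xy | apply: tpK_sqr yx].
  by exists (mulK y y); first exact: intKM.
by exists (mulK x x); [exact: intKM | rewrite mulKC].
Qed.

Lemma intK_eps : intK eps.
Proof. by have := intK_power 1 1 0; rewrite mulr0z. Qed.

Lemma intK_ieps : intK (ieps m).
Proof.
have := intK_power 2 (n%:Z + 1) (-1); congr intK; rewrite /ieps.
by congr (_, _, _); ring.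
Qed.

Lemma unitK_ieps2 : unitK (mulK (ieps m) (ieps m)).
Proof. exact: (unitK_sqr _ _ intK_eps intK_ieps (eps_ieps m)).2. Qed.

Lemma unitK_eps2 : unitK (mulK eps eps).
Proof. exact: (unitK_sqr _ _ intK_eps intK_ieps (eps_ieps m)).1. Qed.

Lemma unitK_e2K : unitK e2K.
Proof.
have -> : e2K = mulK (0, 1, 0) (0, 1, 0) by rewrite /e2K; Kfield.
have ir : intK (0, 1, 0) by have := intK_power 0 1 0; rewrite mulr0z.
have ii : intK (- a - 3, - a, 1).
  have := intK_power (- n%:Z - 3) (- n%:Z) 1; congr intK.
  by congr (_, _, _); ring.
by apply: (unitK_sqr _ _ ir ii _).1; Kfield.
Qed.

Lemma unitK_e3K : unitK (e3K m).
Proof. rewrite e3KE; exact: unitKM unitK_e2K unitK_ieps2. Qed.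

Lemma unitK_tauK (x : Kel) : unitK x -> unitK (tauK x).
Proof. by move=> hx; apply: unitKM unitK_e3K _; apply: unitK_sgK. Qed.

Definition decK (x : Kel) : Prop :=
  exists y z, [/\ intK y /\ tpK y, intK z /\ tpK z & x = addK y z].

Definition indK (x : Kel) : Prop := [/\ intK x, tpK x & ~ decK x].

Lemma decK_mul (e x : Kel) : unitK e -> decK x -> decK (mulK e x).
Proof.
case=> ie pe _ [y [z [[iy py] [iz pz] ->]]]; exists (mulK e y), (mulK e z).
by split; [split; [exact: intKM | exact: tpK_mul]..| exact: mulKDr].
Qed.

Lemma decK_sgK (x : Kel) : decK x -> decK (sgK x).
Proof.
case=> [y [z [[iy py] [iz pz] ->]]]; exists (sgK y), (sgK z).
by split; [split; [exact: intK_sgK | exact: tpK_sgK]..| exact: sgKD].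
Qed.

Lemma decK_tauK (x : Kel) : decK x -> decK (tauK x).
Proof. by move/decK_sgK; apply: decK_mul unitK_e3K. Qed.

Lemma indK_mul (e x : Kel) : unitK e -> indK x -> indK (mulK e x).
Proof.
move=> he [ix px nx]; have [ie pe _] := he.
split; [exact: intKM | exact: tpK_mul | move=> hd; apply: nx].
have [f hf ef] := unitK_inv _ he.
by have := decK_mul _ _ hf hd; rewrite mulKA (mulKC _ f) ef mul1K.
Qed.

Lemma indK_sgK (x : Kel) : indK x -> indK (sgK x).
Proof.
case=> ix px nx; split; [exact: intK_sgK | exact: tpK_sgK | move=> hd; apply: nx].
by rewrite -(sgK3 a x); do 2!apply: decK_sgK.
Qed.

Lemma indK_tauK (x : Kel) : indK x -> indK (tauK x).
Proof. by move/indK_sgK; apply: indK_mul unitK_e3K. Qed.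

Lemma normK_mul (x y : Kel) : normK (mulK x y) = normK x * normK y.
Proof.
apply: (fmorph_inj (ratr : {rmorphism rat -> algC})).
rewrite rmorphM /= !(emb_normK _ _ _ hr) !emb_mul //; ring.
Qed.

Lemma normK_unit (e : Kel) : unitK e -> normK e = 1.
Proof.
move=> he; have [f hf ef] := unitK_inv _ he; case: he hf => ie pe _ [jf pf _].
have := normK_mul e f; rewrite ef.
have -> : normK oneK = 1 by unlockK => /=; ring.
have := intK_normK_ge1 _ ie pe; have := intK_normK_ge1 _ jf pf.
move: (normK e) (normK f) => x y; nra.
Qed.

(** The norm is strictly superadditive on totally positive elements, so a sum of two totally
    positive integers has norm above 2, while a unit has norm 1. *)
Lemma unit_not_decK (e : Kel) : unitK e -> ~ decK e.
Proof.
move=> he [y [z [[iy py] [iz pz] e_yz]]]; have := normK_unit e he.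
have := intK_normK_ge1 _ iy py; have := intK_normK_ge1 _ iz pz.
suff : normK y + normK z < normK e by lra.
rewrite -(ltr_rat algC) rmorphD /= !(emb_normK _ _ _ hr) e_yz !emb_add.
exact: prod3_superadd (py r hr) (py _ hr1) (py _ hr2) (pz r hr) (pz _ hr1) (pz _ hr2).
Qed.

Definition codK (d : Kel) : Prop :=
  forall c, intK c -> exists z : int, traceK (mulK d c) = z%:~R.

Definition minK (c : Kel) (t : rat) : Prop :=
  (exists d, [/\ codK d, tpK d & traceK (mulK d c) = t]) /\
  (forall d, codK d -> tpK d -> t <= traceK (mulK d c)).

Lemma codK_d0K : codK d0K.
Proof.
move=> c /(intKP m) [k [n1 [n2 [n3 [_ ->]]]]].
by exists k; rewrite traceK_d0K levK_V.
Qed.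

Lemma codK_d1K : codK d1K.
Proof.
move=> c /(intKP m) [k [n1 [n2 [n3 [_ ->]]]]].
by exists (n1 + k); rewrite traceK_d1K psiK_V.
Qed.

Lemma codK_mul (e d : Kel) : intK e -> codK d -> codK (mulK e d).
Proof.
move=> ie hd c ic; have [z hz] := hd _ (intKM _ _ ie ic); exists z.
by rewrite -hz (mulKC _ e) -mulKA.
Qed.

Lemma codK_sgK (d : Kel) : codK d -> codK (sgK d).
Proof.
move=> hd c ic; have [z hz] := hd _ (intK_sgK _ (intK_sgK _ ic)); exists z.
by rewrite -hz -(traceK_sgK a (mulK d _)) sgKM sgK3.
Qed.

Lemma codK_ge1 (d x : Kel) : codK d -> tpK d -> intK x -> tpK x ->
  1 <= traceK (mulK d x).
Proof.
move=> cd pd ix px; have [z hz] := cd x ix.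
have := tpK_traceK_gt0 _ (tpK_mul _ _ _ pd px).
by rewrite hz ltr0z -[1]/(1%:~R) ler_int.
Qed.

(** The dual map d |-> e3^-1 s(d) preserves the totally positive codifferent and matches the
    traces. *)
Lemma minK_tauK (c : Kel) (t : rat) : minK c t -> minK (tauK c) t.
Proof.
have [f [jf pf _] ef] := unitK_inv _ unitK_e3K.
case=> -[d [cd pd dc]] hmin; split.
  exists (mulK f (sgK d)); split.
  - by apply: codK_mul => //; apply: codK_sgK.
  - by apply: tpK_mul pf _; apply: tpK_sgK.
  rewrite -dc -(traceK_sgK a (mulK d c)) sgKM /tauK.
  by rewrite (mulKC _ f) -mulKA (mulKA _ f) (mulKC _ f) ef mul1K.
move=> d' cd' pd'; have [ie pe _] := unitK_e3K.
have -> : traceK (mulK d' (tauK c)) =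
    traceK (mulK (sgK (sgK (mulK (e3K m) d'))) c).
  by rewrite -(traceK_sgK a (mulK _ c)) sgKM sgK3 /tauK (mulKC _ _ d') -mulKA.
apply: hmin; last by do 2!apply: tpK_sgK; apply: tpK_mul.
by do 2!apply: codK_sgK; apply: codK_mul.
Qed.

Lemma minK_one_lower (c d : Kel) : intK c -> tpK c -> codK d -> tpK d ->
  traceK (mulK d c) = 1 -> minK c 1.
Proof.
by move=> ic pc cd pd dc; split; [exists d | move=> d' cd' pd'; exact: codK_ge1].
Qed.

(** Each summand of a decomposition would contribute at least 1 to a trace equal to 1. *)
Lemma minK_indK (c : Kel) : intK c -> tpK c -> minK c 1 -> indK c.
Proof.
move=> ic pc [[d [cd pd dc]] _]; split=> // -[y [z [[iy py] [iz pz] e]]].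
have := codK_ge1 d y cd pd iy py; have := codK_ge1 d z cd pd iz pz.
by move: dc; rewrite e mulKDr traceKD; lra.
Qed.

Lemma minK_unit (e : Kel) : unitK e -> minK e 1.
Proof.
move=> he; have [f [jf pf _] ef] := unitK_inv _ he; case: he => ie pe _.
apply: (minK_one_lower _ (mulK f d1K)) => //.
- by apply: codK_mul => //; exact: codK_d1K.
- by apply: tpK_mul pf tpK_d1K.
by rewrite (mulKC _ f) -mulKA (mulKC _ f) ef traceK_d1K (oneK_V m) psiK_V.
Qed.

(** * Decompositions inside the cone *)

Hypothesis m2 : (1 < m)%N.

Let mz2 : 2 <= mz. Proof. by rewrite lez_nat. Qed.

Lemma decV (k n1 n2 n3 k' y1 y2 y3 : int) :
  tpK (V k' y1 y2 y3) -> tpK (V (k - k') (n1 - y1) (n2 - y2) (n3 - y3)) ->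
  decK (V k n1 n2 n3).
Proof.
move=> h1 h2; exists (V k' y1 y2 y3), (V (k - k') (n1 - y1) (n2 - y2) (n3 - y3)).
by split; [split; first exact: intK_V..|]; rewrite // VD; congr V; ring.
Qed.

Lemma decV_rot (k n1 n2 n3 : int) : n1 + n2 + n3 = 3 * mz * k ->
  decK (V k n1 n2 n3) -> decK (V k n2 n3 n1).
Proof. by move=> h /decK_tauK; rewrite tauK_V. Qed.

Lemma tpV_pos (k n1 n2 n3 : int) : n1 + n2 + n3 = 3 * mz * k -> 0 < k ->
  0 <= 3 * n1 + k -> 0 <= 3 * n2 + k -> 0 <= 3 * n3 + k -> tpK (V k n1 n2 n3).
Proof.
move=> h k0 u1 u2 u3.
by apply: tpK_cone => //; rewrite /facet; nia.
Qed.

Lemma tpV_lev2 (n2 n3 : int) : -1 + n2 + n3 = 3 * mz * 2 -> 3 * mz <= n2 ->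
  0 <= n3 -> tpK (V 2 (-1) n2 n3).
Proof.
move=> h h2 h3; have [e | h2'] : n2 = 3 * mz \/ 3 * mz + 1 <= n2 by lia.
  have -> : n3 = 3 * mz + 1 by lia.
  by rewrite e -g3K_V; exact: tpK_g3K.
by apply: tpK_cone => //; rewrite /facet; nia.
Qed.

(** Greedy choice. It supplies a summand y of x when both y and x - y are constrained coordinate by
    coordinate and only the sum of the coordinates of y is prescribed. *)
Lemma box_sum (l1 l2 l3 h1 h2 h3 S : int) : l1 <= h1 -> l2 <= h2 -> l3 <= h3 ->
  l1 + l2 + l3 <= S -> S <= h1 + h2 + h3 ->
  exists y1 y2 y3, [/\ y1 + y2 + y3 = S, l1 <= y1 <= h1, l2 <= y2 <= h2 & l3 <= y3 <= h3].
Proof.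
move=> e1 e2 e3 eS Se.
pose y1 := Num.min h1 (S - l2 - l3); pose y2 := Num.min h2 (S - y1 - l3).
exists y1, y2, (S - y1 - y2); rewrite /y2 /y1; split; lia.
Qed.

(* The vertex 1 of the cone, then the families (v), (vi) and (ii); the other
   families and vertices are cyclic shifts of these. *)
Definition base (k n1 n2 n3 : int) : Prop :=
  [\/ [/\ k = 3, n1 = -2, n2 = 9 * mz + 3 & n3 = -1],
      k = 1 /\ [/\ 0 <= n1, 0 <= n2 & 0 <= n3],
      [/\ k = 2, n1 = -1, 3 * mz + 1 <= n2 & 0 <= n3] |
      [/\ k = 3, n1 = -1 & -1 <= n2 <= 3 * mz - 1]].

Definition dec_or_base (k n1 n2 n3 : int) : Prop :=
  decK (V k n1 n2 n3) \/
  [\/ base k n1 n2 n3, base k n2 n3 n1 | base k n3 n1 n2].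

Lemma dec_or_base_rot (k n1 n2 n3 : int) : n1 + n2 + n3 = 3 * mz * k ->
  dec_or_base k n2 n3 n1 -> dec_or_base k n1 n2 n3.
Proof.
move=> h [hd | [h1|h1|h1]]; [left | right; exact: Or32 | right; exact: Or33 | right; exact: Or31].
by apply: decV_rot; last apply: decV_rot hd; lia.
Qed.

(* The hypothesis says that the coefficient of x at the vertex 1 is at least 1. *)
Lemma dec_sub_e1 (k n1 n2 n3 : int) : n1 + n2 + n3 = 3 * mz * k ->
  let u1 := 3 * n1 + k in let u2 := 3 * n2 + k in let u3 := 3 * n3 + k in
  0 <= facet m u1 u2 u3 -> 0 <= facet m u3 u1 u2 ->
  3 * ((9 * mz + 4) ^+ 3 - 1) <= facet m u2 u3 u1 -> dec_or_base k n1 n2 n3.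
Proof.
move=> h u1 u2 u3 f3 f2 f1; have := facet_sum m k n1 n2 n3 h.
rewrite /= -/u1 -/u2 -/u3 => fs.
have [E1 E2 E3] : [/\ u1 = 3 * n1 + k, u2 = 3 * n2 + k & u3 = 3 * n3 + k] by [].
clearbody u1 u2 u3.
have D0 : 0 < (9 * mz + 4) ^+ 3 - 1 by rewrite subr_gt0 exprn_egt1 //; lia.
have k3 : 3 <= k by rewrite -(ler_pM2l D0) -fs; lia.
have [k3' | {}k3] : k = 3 \/ 3 < k by lia.
  right; apply: Or31; apply: Or41; rewrite k3' in fs E1 E2 E3 h.
  have F3 : facet m u1 u2 u3 = 0 by lia.
  have F2 : facet m u3 u1 u2 = 0 by lia.
  have hu : u1 + u2 + u3 = 3 * (9 * mz + 3) by lia.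
  have hu3 : u3 * ((9 * mz + 4) ^+ 3 - 1) = 0.
    have -> : u3 * ((9 * mz + 4) ^+ 3 - 1) =
      (9 * mz + 4) * facet m u3 u1 u2 - facet m u1 u2 u3 by rewrite /facet; ring.
    by rewrite F2 F3 mulr0 subr0.
  have {}hu3 : u3 = 0.
    by move/eqP: hu3; rewrite mulf_eq0 => /orP[/eqP //|/eqP e]; move: D0; rewrite e.
  have hu2 : u2 = - (9 * mz + 4) * u1 by move: F2; rewrite /facet hu3; lia.
  have hu1 : u1 = -3.
    have : (9 * mz + 3) * (u1 + 3) = 0 by move: hu; rewrite hu2 hu3; lia.
    by move/eqP; rewrite mulf_eq0 => /orP[/eqP|/eqP]; lia.
  by split=> //; lia.
left; apply: (decV _ _ _ _ 3 (-2) (9 * mz + 3) (-1)).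
  by rewrite -oneK_V; exact: tpK_one.
(* Subtracting the vertex 1 changes u by (3, -3q, 0) with q = 9m + 4, which alters only the facet
   form of that vertex, by -3 (q^3 - 1). *)
have e1 : 3 * (n1 - -2) + (k - 3) = u1 + 3 by rewrite E1; ring.
have e2 : 3 * (n2 - (9 * mz + 3)) + (k - 3) = u2 - 3 * (9 * mz + 4) by rewrite E2; ring.
have e3 : 3 * (n3 - -1) + (k - 3) = u3 by rewrite E3; ring.
apply: tpK_cone; rewrite ?e1 ?e2 ?e3; [lia | lia | | |].
- by move: f3; congr (_ <= _); rewrite /facet; ring.
- by rewrite -subr_ge0 in f1; move: f1; congr (_ <= _); rewrite /facet; ring.
- by move: f2; congr (_ <= _); rewrite /facet; ring.
Qed.

(** A summand of level 3 with coordinates >= -1 has u >= 0; so has the remainder, of level k - 3 >=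
    3 with coordinates >= -1. *)
Lemma dec_lev3_step (k n1 n2 n3 : int) : n1 + n2 + n3 = 3 * mz * k -> 6 <= k ->
  -2 <= n1 -> -2 <= n2 -> -2 <= n3 -> decK (V k n1 n2 n3).
Proof.
move=> h k6 h1 h2 h3.
have [] := box_sum (-1) (-1) (-1) (n1 + 1) (n2 + 1) (n3 + 1) (9 * mz); try lia.
  by nia.
move=> y1 [y2 [y3 [ys b1 b2 b3]]].
by apply: (decV _ _ _ _ 3 y1 y2 y3); apply: tpV_pos; lia.
Qed.

(** The summand has level 1 and nonnegative coordinates. The remainder has coordinates >= -c, and 3
    c <= k - 1 makes its u nonnegative. *)
Lemma dec_lev1_step (k n1 n2 n3 c : int) : n1 + n2 + n3 = 3 * mz * k -> 2 <= k ->
  0 <= c -> 3 * c <= k - 1 -> - c <= n1 -> - c <= n2 -> - c <= n3 ->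
  decK (V k n1 n2 n3).
Proof.
move=> h k2 c0 ck h1 h2 h3.
have [] := box_sum 0 0 0 (n1 + c) (n2 + c) (n3 + c) (3 * mz); try lia.
  by nia.
move=> y1 [y2 [y3 [ys b1 b2 b3]]].
by apply: (decV _ _ _ _ 1 y1 y2 y3); apply: tpV_pos; lia.
Qed.

(** Off the families (ii) and (iv), a level 2 element with first coordinate -1 can be split off,
    with nonnegative coordinates left at level 1; [s] is the least second coordinate allowed. *)
Lemma dec_or_base_lev3 (n2 n3 : int) : -1 + n2 + n3 = 3 * mz * 3 ->
  -1 <= n2 -> -1 <= n3 -> dec_or_base 3 (-1) n2 n3.
Proof.
move=> h h2 h3.
have [h2' | h2'] := lerP n2 (3 * mz - 1).
  by right; apply: Or31; apply: Or44; split=> //; lia.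
have [e | {}h3] : n3 = -1 \/ 0 <= n3 by lia.
  by right; apply: Or33; apply: Or44; split=> //; lia.
left; pose s := Num.max (3 * mz) (6 * mz + 1 - n3).
have hs : [/\ 3 * mz <= s, s <= 6 * mz + 1, s <= n2 & 6 * mz + 1 - n3 <= s].
  by rewrite /s; split; lia.
case: hs => s1 s2 s3 s4.
apply: (decV _ _ _ _ 2 (-1) s (6 * mz + 1 - s)).
  by apply: tpV_lev2; lia.
by apply: tpV_pos; lia.
Qed.

(** For n3 = -1 the vertex 1 splits off. Otherwise the coordinate -2 is shared evenly by two
    elements of level 2. *)
Lemma dec_lev4 (n2 n3 : int) : -2 + n2 + n3 = 3 * mz * 4 ->
  6 * mz + 1 <= n2 -> -1 <= n3 -> decK (V 4 (-2) n2 n3).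
Proof.
move=> h h2 h3; have [e | {}h3] : n3 = -1 \/ 0 <= n3 by lia.
  apply: (decV _ _ _ _ 3 (-2) (9 * mz + 3) (-1)).
    by rewrite -oneK_V; exact: tpK_one.
  by apply: tpV_pos; lia.
pose s := Num.min (6 * mz + 1) (n2 - 3 * mz).
have [s1 s2 s3 s4] : [/\ 3 * mz <= s, s <= 6 * mz + 1, 3 * mz <= n2 - s &
   n2 - s <= 6 * mz + 1] by rewrite /s; split; lia.
by apply: (decV _ _ _ _ 2 (-1) s (6 * mz + 1 - s)); apply: tpV_lev2; lia.
Qed.

(** The coordinate -2 is shared by an element of level 2 and one of level 3 whose coordinates are
    all at least -1. *)
Lemma dec_lev5 (n2 n3 : int) : -2 + n2 + n3 = 3 * mz * 5 ->
  3 * mz - 1 <= n2 -> -1 <= n3 -> decK (V 5 (-2) n2 n3).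
Proof.
move=> h h2 h3; pose s := Num.max (3 * mz) (6 * mz - n3).
have [s1 s2 s3 s4] : [/\ 3 * mz <= s, s <= 6 * mz + 1, s <= n2 + 1 &
   6 * mz - n3 <= s] by rewrite /s; split; lia.
apply: (decV _ _ _ _ 2 (-1) s (6 * mz + 1 - s)); first by apply: tpV_lev2; lia.
by apply: tpV_pos; lia.
Qed.

(** Once u3 is eliminated by the sum condition, the facet form has the positive factor 9m + 3. Hence
    a negative u1 forces u2 to be large. *)
Lemma facet_bound (k n1 n2 n3 c : int) : n1 + n2 + n3 = 3 * mz * k ->
  0 <= facet m (3 * n1 + k) (3 * n2 + k) (3 * n3 + k) -> 3 * n1 + k = - c ->
  c * (9 * mz + 5) <= 3 * n2 + k + k.
Proof.
move=> h f e.
have e3 : 3 * n3 + k = (9 * mz + 3) * k + c - (3 * n2 + k) by lia.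
rewrite /facet e e3 in f.
have : 0 <= (9 * mz + 3) * (3 * n2 + k + k - c * (9 * mz + 5)).
  by move: f; congr (_ <= _); ring.
by rewrite pmulr_rge0 ?subr_ge0 //; lia.
Qed.

(** If no vertex can be subtracted, every cone coefficient is below 1. As each vertex has level 3,
    this gives k < 9, and the coordinates u stay above -3. *)
Lemma cone_dec_or_base (k n1 n2 n3 : int) : n1 + n2 + n3 = 3 * mz * k -> 0 < k ->
  0 <= facet m (3 * n1 + k) (3 * n2 + k) (3 * n3 + k) ->
  0 <= facet m (3 * n2 + k) (3 * n3 + k) (3 * n1 + k) ->
  0 <= facet m (3 * n3 + k) (3 * n1 + k) (3 * n2 + k) ->
  dec_or_base k n1 n2 n3.
Proof.
have D0 : 0 < (9 * mz + 4) ^+ 3 - 1 by rewrite subr_gt0 exprn_egt1 //; lia.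
move=> h k0 f3 f1 f2.
have [|g1] := lerP (3 * ((9 * mz + 4) ^+ 3 - 1)) (facet m (3 * n2 + k) (3 * n3 + k) (3 * n1 + k)).
  exact: dec_sub_e1.
have h' : n2 + n3 + n1 = 3 * mz * k by lia.
have h'' : n3 + n1 + n2 = 3 * mz * k by lia.
have [|g2] := lerP (3 * ((9 * mz + 4) ^+ 3 - 1)) (facet m (3 * n3 + k) (3 * n1 + k) (3 * n2 + k)).
  by move=> ?; apply: dec_or_base_rot => //; apply: dec_sub_e1.
have [|g3] := lerP (3 * ((9 * mz + 4) ^+ 3 - 1)) (facet m (3 * n1 + k) (3 * n2 + k) (3 * n3 + k)).
  by move=> ?; do 2!apply: dec_or_base_rot => //; apply: dec_sub_e1.
have fs := facet_sum m k n1 n2 n3 h; rewrite /= in fs.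
have k9 : k < 9 by rewrite -(ltr_pM2l D0) -fs; lia.
(* With q = 9m + 4, q times one facet form minus the next one is (q^3 - 1) times a single
   coordinate. *)
have low x y z : 0 <= facet m x y z -> facet m y z x < 3 * ((9 * mz + 4) ^+ 3 - 1) -> -2 <= x.
  move=> e1 e2; have : - 3 * ((9 * mz + 4) ^+ 3 - 1) < x * ((9 * mz + 4) ^+ 3 - 1).
    have -> : x * ((9 * mz + 4) ^+ 3 - 1) = (9 * mz + 4) * facet m x y z - facet m y z x.
      by rewrite /facet; ring.
    by nia.
  by rewrite ltr_pM2r //; lia.
have l1 := low _ _ _ f3 g1; have l2 := low _ _ _ f1 g2; have l3 := low _ _ _ f2 g3.
have [k6 | k6] := lerP 6 k.
  left; have [k7 | k7] : k = 6 \/ 7 <= k by lia.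
    by apply: dec_lev3_step; lia.
  (* The three facet forms sum to at least 7 (q^3 - 1), q = 9m + 4, and any two of them to less than
     6 (q^3 - 1); so each exceeds q^3 - 1, and every u is nonnegative. *)
  have k7D : ((9 * mz + 4) ^+ 3 - 1) * 7 <= ((9 * mz + 4) ^+ 3 - 1) * k.
    by rewrite ler_pM2l.
  have pos x y z : (9 * mz + 4) ^+ 3 - 1 < facet m x y z ->
      facet m y z x < 3 * ((9 * mz + 4) ^+ 3 - 1) -> 0 <= x.
    move=> e1 e2; have : 0 <= x * ((9 * mz + 4) ^+ 3 - 1).
      have -> : x * ((9 * mz + 4) ^+ 3 - 1) = (9 * mz + 4) * facet m x y z - facet m y z x.
        by rewrite /facet; ring.
      have : 3 * facet m x y z <= (9 * mz + 4) * facet m x y z.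
        by rewrite ler_pM2r; lia.
      by lia.
    by rewrite pmulr_lge0.
  have p1 := pos _ _ _ _ g1; have p2 := pos _ _ _ _ g2; have p3 := pos _ _ _ _ g3.
  by apply: dec_lev3_step => //; lia.
have [k1 | k1] : k = 1 \/ 1 < k by lia.
  (* A coordinate -1 means u = -2, and [facet_bound] then asks for a next coordinate of u exceeding
     what the total 9m + 3 allows. *)
  have b1 x y z : x + y + z = 3 * mz * k -> 0 <= facet m (3 * x + k) (3 * y + k) (3 * z + k) ->
      -2 <= 3 * x + k -> -2 <= 3 * z + k -> 0 <= x.
    rewrite k1 => hx fx x2 z2; rewrite leNgt; apply/negP => x0.
    have ex : x = -1 by lia.
    by have := facet_bound 1 x y z 2 hx fx; lia.
  right; apply: Or31; apply: Or42; split=> //.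
  by split; [apply: (b1 n1 n2 n3) | apply: (b1 n2 n3 n1) | apply: (b1 n3 n1 n2)].
have [k2 | {}k1] : k = 2 \/ 2 < k by lia.
  subst k.
  have b x y z : x + y + z = 3 * mz * 2 -> 0 <= facet m (3 * x + 2) (3 * y + 2) (3 * z + 2) ->
      0 <= facet m (3 * z + 2) (3 * x + 2) (3 * y + 2) ->
      -2 <= 3 * z + 2 -> x = -1 -> dec_or_base 2 x y z.
    move=> hx fx fz z2 ex; have := facet_bound 2 x y z 1 hx fx.
    have zf : z = -1 -> False.
      by move=> ez; have := facet_bound 2 z x y 1 _ fz; lia.
    by right; apply: Or31; apply: Or43; split; lia.
  have [e1 | h1] : n1 = -1 \/ 0 <= n1 by lia.
    exact: b.
  have [e2 | h2] : n2 = -1 \/ 0 <= n2 by lia.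
    by apply: dec_or_base_rot => //; apply: b.
  have [e3 | h3] : n3 = -1 \/ 0 <= n3 by lia.
    by do 2!apply: dec_or_base_rot => //; apply: b.
  by left; apply: (dec_lev1_step 2 _ _ _ 0).
have [k3 | {}k1] : k = 3 \/ 3 < k by lia.
  subst k.
  have [e1 | h1] : n1 = -1 \/ 0 <= n1 by lia.
    by rewrite e1 in h *; apply: dec_or_base_lev3; lia.
  have [e2 | h2] : n2 = -1 \/ 0 <= n2 by lia.
    by apply: dec_or_base_rot => //; rewrite e2 in h' *; apply: dec_or_base_lev3; lia.
  have [e3 | h3] : n3 = -1 \/ 0 <= n3 by lia.
    by do 2!apply: dec_or_base_rot => //; rewrite e3 in h'' *; apply: dec_or_base_lev3; lia.
  by left; apply: (dec_lev1_step 3 _ _ _ 0).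
have [k4 | k5] : k = 4 \/ k = 5 by lia.
  subst k.
  have b x y z : x + y + z = 3 * mz * 4 -> 0 <= facet m (3 * x + 4) (3 * y + 4) (3 * z + 4) ->
      0 <= facet m (3 * z + 4) (3 * x + 4) (3 * y + 4) ->
      -2 <= 3 * z + 4 -> x = -2 -> dec_or_base 4 x y z.
    move=> hx fx fz z2 ex; have := facet_bound 4 x y z 2 hx fx.
    have zf : z = -2 -> False.
      by move=> ez; have := facet_bound 4 z x y 2 _ fz; lia.
    by move=> hy; left; rewrite ex in hx *; apply: dec_lev4; lia.
  have [e1 | h1] : n1 = -2 \/ -1 <= n1 by lia.
    exact: b.
  have [e2 | h2] : n2 = -2 \/ -1 <= n2 by lia.
    by apply: dec_or_base_rot => //; apply: b.
  have [e3 | h3] : n3 = -2 \/ -1 <= n3 by lia.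
    by do 2!apply: dec_or_base_rot => //; apply: b.
  by left; apply: (dec_lev1_step 4 _ _ _ 1).
subst k.
have b x y z : x + y + z = 3 * mz * 5 -> 0 <= facet m (3 * x + 5) (3 * y + 5) (3 * z + 5) ->
    0 <= facet m (3 * z + 5) (3 * x + 5) (3 * y + 5) ->
    -2 <= 3 * z + 5 -> x = -2 -> dec_or_base 5 x y z.
  move=> hx fx fz z2 ex; have := facet_bound 5 x y z 1 hx fx.
  have zf : z = -2 -> False.
    by move=> ez; have := facet_bound 5 z x y 1 _ fz; lia.
  by move=> hy; left; rewrite ex in hx *; apply: dec_lev5; lia.
have [e1 | h1] : n1 = -2 \/ -1 <= n1 by lia.
  exact: b.
have [e2 | h2] : n2 = -2 \/ -1 <= n2 by lia.
  by apply: dec_or_base_rot => //; apply: b.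
have [e3 | h3] : n3 = -2 \/ -1 <= n3 by lia.
  by do 2!apply: dec_or_base_rot => //; apply: b.
by left; apply: (dec_lev1_step 5 _ _ _ 1).
Qed.

(** * Descent to locally minimal multiples *)

Lemma levK_ieps2 (k n1 n2 n3 : int) :
  levK (mulK (mulK (ieps m) (ieps m)) (V k n1 n2 n3)) =
  (k + 3 * ((- k - 2 * n1) - (n3 - k - 2 * n1 - (3 * mz + 1) * (2 * k + 3 * n1))))%:~R.
Proof. by rewrite /levK /ieps /V; Kfield. Qed.

Lemma levK_e3K (k n1 n2 n3 : int) :
  levK (mulK (e3K m) (V k n1 n2 n3)) =
  (k - 3 * (n3 - k - 2 * n1 - (3 * mz + 1) * (2 * k + 3 * n1)))%:~R.
Proof. by rewrite /levK /e3K /V; Kfield. Qed.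

Lemma comb_eq (k n1 n2 n3 : int) :
  let c1 := - k - 2 * n1 in let c3 := 2 * k + 3 * n1 in
  let c2 := n3 - k - 2 * n1 - (3 * mz + 1) * c3 in
  V k n1 n2 n3 = addK (scaleK (c1 - c2)%:~R oneK)
    (addK (scaleK (- c2)%:~R e2K) (scaleK (c3 + 3 * c2)%:~R g3K)).
Proof. by rewrite /V /e2K /g3K /=; Kfield. Qed.

Lemma facet_negE (k n1 n2 n3 : int) : n1 + n2 + n3 = 3 * mz * k ->
  facet m (3 * n1 + k) (3 * n2 + k) (3 * n3 + k) =
  - (9 * mz + 3) * (2 * k + 3 * n1 +
      3 * (n3 - k - 2 * n1 - (3 * mz + 1) * (2 * k + 3 * n1))).
Proof.
move=> h; have -> : n2 = 3 * mz * k - n1 - n3 by lia.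
by rewrite /facet; ring.
Qed.

Lemma tpK_comb (x y z : int) : 0 <= x -> 0 <= y -> 0 <= z -> 0 < x + y + z ->
  tpK (addK (scaleK x%:~R oneK) (addK (scaleK y%:~R e2K) (scaleK z%:~R g3K))).
Proof.
move=> x0 y0 z0 s s' hs; rewrite !emb_add !emb_scale !ratr_int.
have E1 : 0 < emb s' oneK by apply: (tpK_one a).
have E2 := tpK_e2K m s' hs; have E3 := tpK_g3K m s' hs.
have p1 : 0 <= x%:~R * emb s' oneK by rewrite mulr_ge0 ?ler0z // ltW.
have p2 : 0 <= y%:~R * emb s' e2K by rewrite mulr_ge0 ?ler0z // ltW.
have p3 : 0 <= z%:~R * emb s' g3K by rewrite mulr_ge0 ?ler0z // ltW.
have : [|| 0 < x, 0 < y | 0 < z] by lia.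
case/or3P => F0.
- by rewrite ltr_wpDr ?addr_ge0 // mulr_gt0 ?ltr0z.
- by rewrite ltr_wpDl // ltr_wpDr // mulr_gt0 ?ltr0z.
- by rewrite ltr_wpDl // ltr_wpDl // mulr_gt0 ?ltr0z.
Qed.

(** For x = c1 g1 + c2 g2 + c3 g3 the two units change k by 3 (c1 - c2) and -3 c2. The conditions
    thus say that the coefficients of 1 and rho^2 in the basis 1, rho^2, g3 are nonnegative. *)
Definition locmin (x : Kel) : Prop :=
  levK x <= levK (mulK (mulK (ieps m) (ieps m)) x) /\
  levK x <= levK (mulK (e3K m) x).

(** The facet form is -(9m + 3) times the coefficient of g3, so a negative facet makes that
    coefficient positive; then g3 splits off unless nothing else remains. *)
Lemma indK_facet_neg (k n1 n2 n3 : int) : n1 + n2 + n3 = 3 * mz * k ->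
  locmin (V k n1 n2 n3) -> facet m (3 * n1 + k) (3 * n2 + k) (3 * n3 + k) < 0 ->
  indK (V k n1 n2 n3) -> V k n1 n2 n3 = g3K.
Proof.
move=> h; rewrite /locmin levK_ieps2 levK_e3K levK_V !ler_int => -[l1 l2].
rewrite facet_negE // comb_eq.
set c1 := - k - 2 * n1 in l1 l2 *; set c3 := 2 * k + 3 * n1 in l1 l2 *.
set c2 := n3 - k - 2 * n1 - (3 * mz + 1) * c3 in l1 l2 *.
move=> f [_ _ nd]; have c3p : 0 < c3 + 3 * c2.
  by move: f; rewrite mulNr oppr_lt0 pmulr_rgt0 //; lia.
move: (c3 + 3 * c2) c3p nd => g gp nd.
have a0 : 0 <= c1 - c2 by lia.
have b0 : 0 <= - c2 by lia.
clear l1 l2 f; move: (c1 - c2) a0 nd => x x0; move: (- c2) b0 => y y0 nd.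
have [s0 | s0] := lerP (x + y + (g - 1)) 0.
  have -> : x = 0 by lia.
  have -> : y = 0 by lia.
  have -> : g = 1 by lia.
  by rewrite /g3K; Kfield.
case: nd; exists g3K, (addK (scaleK x%:~R oneK) (addK (scaleK y%:~R e2K) (scaleK (g - 1)%:~R g3K))).
have [hx [hy hz]] : intK oneK /\ intK e2K /\ intK g3K.
  by rewrite (oneK_V m) (e2K_V m) (g3K_V m); split; [|split]; exact: intK_V.
split.
- by split; [rewrite (g3K_V m); exact: intK_V | exact: tpK_g3K].
- split; last by apply: tpK_comb => //; lia.
  by exists (x - y), (- y), (g - 1 + 3 * y); rewrite /g3K /e2K; Kfield.
- by rewrite /g3K /e2K; Kfield.
Qed.

Lemma levK_tauK (x : Kel) : intK x -> levK (tauK x) = levK x.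
Proof.
by move=> /(intKP m) [k [n1 [n2 [n3 [h ->]]]]]; rewrite tauK_V // !levK_V.
Qed.

Lemma tauK_mul (e x : Kel) : tauK (mulK e x) = mulK (sgK e) (tauK x).
Proof.
by rewrite /tauK sgKM !mulKA (mulKC _ _ (sgK e)).
Qed.

Lemma sgK_mul_tauK (f x : Kel) : mulK f (tauK x) = tauK (mulK (sgK (sgK f)) x).
Proof. by rewrite tauK_mul sgK3. Qed.

Definition locmin3 (x : Kel) : Prop :=
  [/\ locmin x, locmin (tauK x) & locmin (tauK (tauK x))].

Lemma locmin_dec (x : Kel) :
  locmin x \/ exists2 e, unitK e & levK (mulK e x) < levK x.
Proof.
rewrite /locmin.
have [l1 | l1] := lerP (levK x) (levK (mulK (mulK (ieps m) (ieps m)) x)); last first.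
  by right; exists (mulK (ieps m) (ieps m)); first exact: unitK_ieps2.
have [l2 | l2] := lerP (levK x) (levK (mulK (e3K m) x)); first by left.
by right; exists (e3K m); first exact: unitK_e3K.
Qed.

(** A unit lowering k on tau x is moved back to x through f tau(x) = tau(s^2(f) x), because tau
    preserves k. *)
Lemma locmin3_dec (x : Kel) : intK x ->
  locmin3 x \/ exists2 e, unitK e & levK (mulK e x) < levK x.
Proof.
move=> ix; have i1 := intK_tauK x ix; have i2 := intK_tauK _ i1.
case: (locmin_dec x) => [h0 | ]; last by right.
case: (locmin_dec (tauK x)) => [h1 | [e he l1]]; last first.
  have he' := unitK_sgK _ (unitK_sgK _ he).
  right; exists (sgK (sgK e)) => //; have [ie _ _] := he'.
  by move: l1; rewrite sgK_mul_tauK !levK_tauK //; apply: intKM.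
case: (locmin_dec (tauK (tauK x))) => [h2 | [e he l2]]; first by left.
have he' := unitK_sgK _ (unitK_sgK _ he).
have he'' := unitK_sgK _ (unitK_sgK _ he').
have [ie _ _] := he'; have [ie' _ _] := he''.
right; exists (sgK (sgK (sgK (sgK e)))) => //.
move: l2; rewrite !sgK_mul_tauK !levK_tauK //; first exact: intKM.
by apply: intK_tauK; apply: intKM.
Qed.

Lemma locmin3_exists (x : Kel) : intK x -> tpK x ->
  exists2 e, unitK e & locmin3 (mulK e x).
Proof.
move=> ix px; have [N hN] : exists N : nat, levK x < N%:R.
  have [k [n1 [n2 [n3 [_ ->]]]]] := intKP m x ix.
  exists `|k|.+1%N; rewrite levK_V pmulrn ltr_int; lia.
elim: N x ix px hN => [|N IH] x ix px hN.
  have := tpK_traceK_gt0 _ (tpK_mul _ _ _ tpK_d0K px).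
  by rewrite traceK_d0K; lra.
case: (locmin3_dec _ ix) => [h | [e he l]].
  by exists oneK; [exact: unitK_one | rewrite mul1K].
have [ie pe _] := he.
have ix' := intKM _ _ ie ix; have px' := tpK_mul _ _ _ pe px.
have [|f hf h] := IH _ ix' px'.
  have [k [n1 [n2 [n3 [_ hk]]]]] := intKP m x ix.
  have [k' [n1' [n2' [n3' [_ hk']]]]] := intKP m _ ix'.
  move: l hN; rewrite hk' hk !levK_V !pmulrn !ltr_int; lia.
by exists (mulK f e); [exact: unitKM | rewrite -mulKA].
Qed.

Definition listedK (x : Kel) : Prop :=
  x = g3K \/ exists k n1 n2 n3, [/\ n1 + n2 + n3 = 3 * mz * k, x = V k n1 n2 n3 &
    [\/ base k n1 n2 n3, base k n2 n3 n1 | base k n3 n1 n2]].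

(** All elements found beyond the three faces are therefore unit multiples of the single g3. *)
Lemma tauK_g3K : tauK g3K = mulK (mulK (ieps m) (ieps m)) g3K.
Proof. by rewrite /tauK /g3K /e3K /ieps; Kfield. Qed.

Lemma locmin3_indK (x : Kel) : locmin3 x -> indK x ->
  exists e y, [/\ unitK e, listedK y & x = mulK e y].
Proof.
move=> [l0 l1 l2] hi; have [ix px nd] := hi.
have hi1 := indK_tauK _ hi; have hi2 := indK_tauK _ hi1.
have [k [n1 [n2 [n3 [h e]]]]] := intKP m x ix.
have h' : n2 + n3 + n1 = 3 * mz * k by lia.
have h'' : n3 + n1 + n2 = 3 * mz * k by lia.
have u1 := unitK_ieps2; have u1' := unitK_sgK _ u1.
rewrite e ?tauK_V // ?tauK_V // in px nd l0 l1 l2 hi hi1 hi2 *.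
have [k0 _ _ _] := levK_V_ge1 _ _ _ _ h px.
have [f1 | f1] := lerP 0 (facet m (3 * n1 + k) (3 * n2 + k) (3 * n3 + k)); last first.
  exists oneK, g3K; split; [exact: unitK_one | by left | ].
  by rewrite mul1K; exact: indK_facet_neg.
have [f2 | f2] := lerP 0 (facet m (3 * n2 + k) (3 * n3 + k) (3 * n1 + k)); last first.
  (* Here tau x = g3. As tau has order 3 on integers, x = tau^2 g3, and [tauK_g3K] applies twice. *)
  exists (mulK (sgK (mulK (ieps m) (ieps m))) (mulK (ieps m) (ieps m))), g3K.
  split; [exact: unitKM | by left | ].
  rewrite -mulKA -tauK_g3K -tauK_mul -tauK_g3K.
  by rewrite -(indK_facet_neg _ _ _ _ h' l1 f2 hi1) !tauK_V.
have [f3 | f3] := lerP 0 (facet m (3 * n3 + k) (3 * n1 + k) (3 * n2 + k)); last first.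
  exists (mulK (ieps m) (ieps m)), g3K; split; [exact: u1 | by left | ].
  by rewrite -tauK_g3K -(indK_facet_neg _ _ _ _ h'' l2 f3 hi2) !tauK_V.
exists oneK, (V k n1 n2 n3); split; [exact: unitK_one | right | by rewrite mul1K].
exists k, n1, n2, n3; split=> //.
by case: (cone_dec_or_base k n1 n2 n3 h _ f1 f2 f3); rewrite ?nd //; lia.
Qed.

Lemma indK_listed (x : Kel) : indK x ->
  exists e y, [/\ unitK e, listedK y & x = mulK e y].
Proof.
move=> hi; have [ix px _] := hi.
have [f hf lm] := locmin3_exists _ ix px.
have [e [y [he hy e_fx]]] := locmin3_indK _ lm (indK_mul _ _ hf hi).
have [f' hf' ff'] := unitK_inv _ hf.
exists (mulK f' e), y; split; [exact: unitKM | by [] |].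
by rewrite -mulKA -e_fx mulKA (mulKC _ f') ff' mul1K.
Qed.

(* The norm of V 1 n1 n2 n3 has nonnegative coefficients once 3m is replaced by
   n1 + n2 + n3. *)
Lemma normK_lev1 (n1 n2 n3 : int) : n1 + n2 + n3 = 3 * mz * 1 ->
  0 <= n1 -> 0 <= n2 -> 0 <= n3 -> 1 < normK (V 1 n1 n2 n3).
Proof.
move=> h h1 h2 h3.
have e : M = (n1%:~R + n2%:~R + n3%:~R) / 3.
  have := congr1 (intr : int -> rat) h.
  by rewrite !(intrD, intrM) -!pmulrn; lra.
have -> : V 1 n1 n2 n3 = gel (- 1 - 2 * n1%:~R)
    (n3%:~R - 1 - 2 * n1%:~R - (3 * M + 1) * (2 + 3 * n1%:~R)) (2 + 3 * n1%:~R).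
  by rewrite /V; congr gel; ring.
rewrite /gel aE; unlockK => /=.
have x0 : (0 : rat) <= n1%:~R by rewrite ler0z.
have y0 : (0 : rat) <= n2%:~R by rewrite ler0z.
have z0 : (0 : rat) <= n3%:~R by rewrite ler0z.
have s0 : (6 : rat) <= n1%:~R + n2%:~R + n3%:~R.
  by rewrite -!intrD -[6]/(6%:~R) ler_int; lia.
rewrite e; move: (n1%:~R) (n2%:~R) (n3%:~R) x0 y0 z0 s0 => x y z x0 y0 z0 s0.
have xy := mulr_ge0 x0 y0; have xz := mulr_ge0 x0 z0; have yz := mulr_ge0 y0 z0.
have xyz := mulr_ge0 xy z0.
have [] := (mulr_ge0 x0 x0, mulr_ge0 y0 y0, mulr_ge0 z0 z0) => -[xx yy] zz.
have [] := (mulr_ge0 xy x0, mulr_ge0 xy y0, mulr_ge0 xz x0) => -[xyx xyy] xzx.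
have [] := (mulr_ge0 xz z0, mulr_ge0 yz y0, mulr_ge0 yz z0) => -[xzz yzy] yzz.
have [] := (mulr_ge0 xyz x0, mulr_ge0 xyz y0, mulr_ge0 xyz z0) => -[q1 q2] q3.
set N := (X in 1 < X).
have -> : N = 1 + 2 * (x + y + z) + (13 / 3 * (x * y + x * z + y * z)
  + 9 * (x * y * z) + 3 * (x * y * z * x + x * y * z * y + x * y * z * z)
  + x * y * y + y * z * z + x * z * x + 2 * (x * z * z + x * y * x + y * z * y)
  + 2 / 3 * (x * x + y * y + z * z)).
  by rewrite /N; field.
by lra.
Qed.

(** * Elements of levels 2 and 3, and the units of least level *)

Lemma levK_e2K (k n1 n2 n3 : int) :
  let c1 := - k - 2 * n1 in let c3 := 2 * k + 3 * n1 in
  let c2 := n3 - k - 2 * n1 - (3 * mz + 1) * c3 in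
  levK (mulK e2K (V k n1 n2 n3)) = (3 * (9 * mz + 4) * c2 +
     ((9 * mz + 3) ^+ 2 + 3 * (9 * mz + 3) + 5) * c3 + 3 * c1)%:~R.
Proof. by rewrite /levK /e2K /V /=; Kfield. Qed.

Lemma levK_gt0 (x : Kel) : tpK x -> 0 < levK x.
Proof. by rewrite -traceK_d0K => px; apply: tpK_traceK_gt0 (tpK_mul _ _ _ tpK_d0K px). Qed.

(** k must be positive on the multiples by (1 + rho)^-2 and by rho^2. The bounds match the
    hypotheses of [tpV_lev2]. *)
Lemma tpV_lev2_bounds (n2 n3 : int) : -1 + n2 + n3 = 3 * mz * 2 ->
  tpK (V 2 (-1) n2 n3) -> 3 * mz <= n2 /\ 0 <= n3.
Proof.
move=> h p; split.
  have := levK_gt0 _ (tpK_mul _ _ _ (tpK_ieps2 m) p).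
  by rewrite levK_ieps2 ltr0z; lia.
have := levK_gt0 _ (tpK_mul _ _ _ (tpK_e2K m) p).
rewrite levK_e2K ltr0z => h3; rewrite leNgt; apply/negP => n30.
have : (9 * mz + 4) * n3 <= - (9 * mz + 4) by nia.
by nia.
Qed.

(** With s the distance of n3 from its value at g3, the norm is del + s (3 del - s^2), and s <= 3m +
    1 gives s^2 <= 3 del. *)
Lemma normK_lev2 (n2 n3 : int) : -1 + n2 + n3 = 3 * mz * 2 ->
  tpK (V 2 (-1) n2 n3) -> 1 < normK (V 2 (-1) n2 n3).
Proof.
move=> h /(tpV_lev2_bounds _ _ h) [h2 h3]; pose s := 3 * mz + 1 - n3.
have s0 : 0 <= s by rewrite /s; lia.
have sm : s <= 3 * mz + 1 by rewrite /s; lia.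
have -> : normK (V 2 (-1) n2 n3) =
    (1 + 3 * mz + 3 * mz ^+ 2 + s * (3 + 9 * mz + 9 * mz ^+ 2 - s ^+ 2))%:~R.
  by rewrite /V /s; Kfield.
rewrite -[1]/(1%:~R) ltr_int.
have : 0 <= s * (3 + 9 * mz + 9 * mz ^+ 2 - s ^+ 2) by rewrite mulr_ge0 //; nia.
by nia.
Qed.

(* (3 m + 2) x is a sum of 3 m + n2 + 4 > 3 m + 2 totally positive integers. *)
Lemma minK_lev3 (n2 n3 : int) : -1 + n2 + n3 = 3 * mz * 3 ->
  -1 <= n2 <= 3 * mz - 1 -> minK (V 3 (-1) n2 n3) 2.
Proof.
move=> h /andP [h2 h2']; split.
  exists d1K; split; [exact: codK_d1K | exact: tpK_d1K |].
  by rewrite traceK_d1K psiK_V.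
move=> d cd pd; have [z hz] := cd _ (intK_V m 3 (-1) n2 n3).
have i2 : intK e2K by rewrite (e2K_V m); exact: intK_V.
have i3 : intK g3K by rewrite (g3K_V m); exact: intK_V.
have p1 : tpK (V 1 0 0 (3 * mz)) by apply: tpV_pos; lia.
have t2 := codK_ge1 d _ cd pd i2 (tpK_e2K m).
have t3 := codK_ge1 d _ cd pd i3 (tpK_g3K m).
have t1 := codK_ge1 d _ cd pd (intK_V m _ _ _ _) p1.
have e : scaleK (3 * mz + 2)%:~R (V 3 (-1) n2 n3) =
  addK (scaleK (3 * mz - n2)%:~R e2K)
    (addK (scaleK (n2 + 2)%:~R g3K) (scaleK (n2 + 2)%:~R (V 1 0 0 (3 * mz)))).
  have -> : n3 = 9 * mz + 1 - n2 by lia.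
  by rewrite /V /e2K /g3K; Kfield.
have traceK_lin q x : traceK (mulK d (scaleK q x)) = q * traceK (mulK d x).
  by Kfield.
have := congr1 (fun x => traceK (mulK d x)) e.
rewrite /= !mulKDr !traceKD !traceK_lin => eq.
rewrite hz in eq.
have le2 : (3 * mz - n2)%:~R <= (3 * mz - n2)%:~R * traceK (mulK d e2K).
  by rewrite ler_peMr // ler0z; lia.
have le3 : (n2 + 2)%:~R <= (n2 + 2)%:~R * traceK (mulK d g3K).
  by rewrite ler_peMr // ler0z; lia.
have le1 : (n2 + 2)%:~R <= (n2 + 2)%:~R * traceK (mulK d (V 1 0 0 (3 * mz))).
  by rewrite ler_peMr // ler0z; lia.
have hh : 3 * mz - n2 + (n2 + 2) + (n2 + 2) <= (3 * mz + 2) * z.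
  by rewrite -(ler_int rat) [X in _ <= X]intrM eq !intrD; lra.
have z2 : 2 <= z by rewrite leNgt; apply/negP => z2; nia.
by rewrite hz -[2]/(2%:~R) ler_int.
Qed.

(** k = 3 splits as 1 + 2 and psi = 2 as 1 + 1, so the summand of level 2 has first coordinate -1
    and second coordinate >= 3m. The other has second coordinate >= 0, contradicting n2 <= 3m -
    1. *)
Lemma indK_lev3 (n2 n3 : int) : -1 + n2 + n3 = 3 * mz * 3 ->
  -1 <= n2 <= 3 * mz - 1 -> indK (V 3 (-1) n2 n3).
Proof.
move=> h /andP [h2 h2']; split; [exact: intK_V | by apply: tpV_pos; lia |].
case=> y [z [[iy py] [iz pz]]].
have [k [y1 [y2 [y3 [hy ey]]]]] := intKP m y iy.
have [l [z1 [z2 [z3 [hz' ez]]]]] := intKP m z iz.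
rewrite ey ez in py pz *; rewrite VD => /V_inj [e1 e2 e3] {iy iz ey ez}.
have [k1 by1 by2 by3] := levK_V_ge1 _ _ _ _ hy py.
have [l1 bz1 bz2 bz3] := levK_V_ge1 _ _ _ _ hz' pz.
have [[ek el] | [ek el]] : (k = 1 /\ l = 2) \/ (k = 2 /\ l = 1) by lia.
  subst k l; have ez1 : z1 = -1 by lia.
  by rewrite ez1 in hz' pz e2; have [] := tpV_lev2_bounds _ _ hz' pz; lia.
subst k l; have ey1 : y1 = -1 by lia.
by rewrite ey1 in hy py e2; have [] := tpV_lev2_bounds _ _ hy py; lia.
Qed.

Lemma minK_uniq (c : Kel) (s t : rat) : minK c s -> minK c t -> s = t.
Proof.
move=> [[d [cd pd ds]] hs] [[d' [cd' pd' dt]] ht]; apply: le_anti.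
by rewrite -{1}dt -{2}ds hs ?ht.
Qed.

Lemma unitK_rot (k n1 n2 n3 : int) : n1 + n2 + n3 = 3 * mz * k ->
  unitK (V k n1 n2 n3) -> unitK (V k n2 n3 n1).
Proof. by move=> h /unitK_tauK; rewrite tauK_V. Qed.

(** Positivity of k on two unit multiples leaves n3 = -1 or n3 = 0; the latter is 1 + rho, of norm
    -1. *)
Lemma unit_lev3_corner (n2 n3 : int) : -2 + n2 + n3 = 3 * mz * 3 ->
  tpK (V 3 (-2) n2 n3) -> n2 = 9 * mz + 3 /\ n3 = -1.
Proof.
move=> h p; suff : n3 = -1 by lia.
have := levK_gt0 _ (tpK_mul _ _ _ (tpK_ieps2 m) p).
have := levK_gt0 _ (tpK_mul _ _ _ (tpK_e2K m) p).
rewrite levK_e2K levK_ieps2 !ltr0z => b1 b2.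
have n3l : -1 <= n3.
  rewrite leNgt; apply/negP => n30.
  have : (9 * mz + 4) * (n3 + 1) <= - (9 * mz + 4) by nia.
  by nia.
have [// | e] : n3 = -1 \/ n3 = 0 by lia.
have := tpK_normK_gt0 _ p; have -> : V 3 (-2) n2 n3 = eps.
  by rewrite e /V /eps; Kfield.
have -> : normK eps = -1 by rewrite /eps; unlockK => /=; ring.
by rewrite oppr_gt0 ltr10.
Qed.

Lemma not_unit_lev3 (n2 n3 : int) : -1 + n2 + n3 = 3 * mz * 3 ->
  -1 <= n2 <= 3 * mz - 1 -> ~ unitK (V 3 (-1) n2 n3).
Proof. by move=> h h2 /minK_unit /(minK_uniq _ _ _ (minK_lev3 _ _ h h2)). Qed.

Lemma unit_base (n1 n2 n3 : int) : n1 + n2 + n3 = 3 * mz * 3 ->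
  base 3 n1 n2 n3 -> unitK (V 3 n1 n2 n3) ->
  [/\ n1 = -2, n2 = 9 * mz + 3 & n3 = -1].
Proof.
move=> h [[_ -> -> ->] | [] // | [] // | [_ e h2]] hu //.
by rewrite e in h hu; case: (not_unit_lev3 _ _ h h2).
Qed.

(** At levels 1 and 2 the element has norm above 1 or decomposes. At level 3 it is a vertex,
    decomposes, or belongs to (ii)-(iv), whose minimal trace 2 differs from the minimal trace 1 of
    units. *)
Lemma unit_lev (k n1 n2 n3 : int) : n1 + n2 + n3 = 3 * mz * k ->
  unitK (V k n1 n2 n3) ->
  3 <= k /\ (k = 3 -> [\/ V k n1 n2 n3 = oneK, V k n1 n2 n3 = e2K | V k n1 n2 n3 = e3K m]).
Proof.
move=> h hu; have [_ pu _] := hu.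
have h' : n2 + n3 + n1 = 3 * mz * k by lia.
have h'' : n3 + n1 + n2 = 3 * mz * k by lia.
have hu' := unitK_rot _ _ _ _ h hu; have hu'' := unitK_rot _ _ _ _ h' hu'.
have [k1 b1 b2 b3] := levK_V_ge1 _ _ _ _ h pu.
have nd := unit_not_decK _ hu.
have [e1 | {}k1] : k = 1 \/ 1 < k by lia.
  subst k; have n10 : 0 <= n1 by lia.
  have n20 : 0 <= n2 by lia.
  have n30 : 0 <= n3 by lia.
  by have := normK_lev1 n1 n2 n3 h n10 n20 n30; rewrite normK_unit // ltxx.
have [e2 | {}k1] : k = 2 \/ 2 < k by lia.
  subst k.
  have bad x y z : x + y + z = 3 * mz * 2 -> unitK (V 2 x y z) -> x = -1 -> False.
    move=> hx ux ex; rewrite ex in hx ux; have [_ px _] := ux.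
    by have := normK_lev2 _ _ hx px; rewrite normK_unit // ltxx.
  have [/(bad _ _ _ h hu) // | n10] : n1 = -1 \/ 0 <= n1 by lia.
  have [/(bad _ _ _ h' hu') // | n20] : n2 = -1 \/ 0 <= n2 by lia.
  have [/(bad _ _ _ h'' hu'') // | n30] : n3 = -1 \/ 0 <= n3 by lia.
  by case: nd; apply: (dec_lev1_step 2 _ _ _ 0).
split=> [|k3]; first by lia.
subst k.
have corner x y z : x + y + z = 3 * mz * 3 -> unitK (V 3 x y z) -> x = -2 ->
    y = 9 * mz + 3 /\ z = -1.
  by move=> hx ux ex; rewrite ex in hx ux; have [_ px _] := ux; exact: unit_lev3_corner.
have one x y z : [/\ x = -2, y = 9 * mz + 3 & z = -1] ->
    [\/ n1 = x /\ n2 = y /\ n3 = z, n2 = x /\ n3 = y /\ n1 = z | n3 = x /\ n1 = y /\ n2 = z] ->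
   [\/ V 3 n1 n2 n3 = oneK, V 3 n1 n2 n3 = e2K | V 3 n1 n2 n3 = e3K m].
  move=> [-> -> ->] [[-> [-> ->]] | [-> [-> ->]] | [-> [-> ->]]].
  - by apply: Or31; rewrite (oneK_V m).
  - by apply: Or32; rewrite (e2K_V m).
  - by apply: Or33; rewrite e3K_V.
have [e1 | n10] : n1 = -2 \/ -1 <= n1 by lia.
  have [c1 c2] := corner _ _ _ h hu e1.
  by apply: (one n1 n2 n3) => //; exact: Or31.
have [e2 | n20] : n2 = -2 \/ -1 <= n2 by lia.
  have [c1 c2] := corner _ _ _ h' hu' e2.
  by apply: (one n2 n3 n1) => //; exact: Or32.
have [e3 | n30] : n3 = -2 \/ -1 <= n3 by lia.
  have [c1 c2] := corner _ _ _ h'' hu'' e3.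
  by apply: (one n3 n1 n2) => //; exact: Or33.
have fin : dec_or_base 3 n1 n2 n3 -> [\/ V 3 n1 n2 n3 = oneK, V 3 n1 n2 n3 = e2K | V 3 n1 n2 n3 = e3K m].
  case=> [/nd // | [hb | hb | hb]].
  - by have := unit_base _ _ _ h hb hu => b; apply: (one n1 n2 n3) => //; exact: Or31.
  - by have := unit_base _ _ _ h' hb hu' => b; apply: (one n2 n3 n1) => //; exact: Or32.
  - by have := unit_base _ _ _ h'' hb hu'' => b; apply: (one n3 n1 n2) => //; exact: Or33.
have [e1 | {}n10] : n1 = -1 \/ 0 <= n1 by lia.
  by rewrite e1 in h fin *; apply/fin/dec_or_base_lev3.
have [e2 | {}n20] : n2 = -1 \/ 0 <= n2 by lia.
  apply/fin/dec_or_base_rot => //.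
  by rewrite e2 in h' *; apply: dec_or_base_lev3; lia.
have [e3 | {}n30] : n3 = -1 \/ 0 <= n3 by lia.
  apply/fin/dec_or_base_rot => //; apply: dec_or_base_rot => //.
  by rewrite e3 in h'' *; apply: dec_or_base_lev3; lia.
by case: nd; apply: (dec_lev1_step 3 _ _ _ 0).
Qed.

Lemma unit_levK (e : Kel) : unitK e ->
  3 <= levK e /\ (levK e = 3 -> [\/ e = oneK, e = e2K | e = e3K m]).
Proof.
move=> he; have [ie _ _] := he; have [k [n1 [n2 [n3 [h ee]]]]] := intKP m e ie.
rewrite ee in he *; have [k3 k3e] := unit_lev _ _ _ _ h he.
rewrite levK_V -[3]/(3%:~R) ler_int; split=> // /intr_inj; exact: k3e.
Qed.

Definition interior (k n1 n2 n3 : int) : Prop :=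
  [/\ 0 < facet m (3 * n1 + k) (3 * n2 + k) (3 * n3 + k),
      0 < facet m (3 * n2 + k) (3 * n3 + k) (3 * n1 + k) &
      0 < facet m (3 * n3 + k) (3 * n1 + k) (3 * n2 + k)].

Lemma levK_scale (q : rat) (x : Kel) : levK (scaleK q x) = q * levK x.
Proof. by rewrite /levK; unlockK => /=; ring. Qed.

Lemma mulK_scale (q : rat) (x y : Kel) : mulK x (scaleK q y) = scaleK q (mulK x y).
Proof. by Kfield. Qed.

(** In the interior all three vertices have positive weight, so equality forces k = 3 on e, e rho^2
    and e e3 simultaneously. *)
Lemma levK_unit_mul (e : Kel) (k n1 n2 n3 : int) : n1 + n2 + n3 = 3 * mz * k ->
  interior k n1 n2 n3 -> unitK e ->
  k%:~R <= levK (mulK e (V k n1 n2 n3)) /\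
  (levK (mulK e (V k n1 n2 n3)) = k%:~R -> e = oneK).
Proof.
move=> h [f3 f1 f2] he.
have := congr1 (fun x => levK (mulK e x)) (cone_eq m k n1 n2 n3 h).
have := congr1 (intr : int -> rat) (facet_sum m k n1 n2 n3 h).
rewrite /= !mulKDr !mulK_scale !levKD !levK_scale (mulKC _ e oneK) mul1K.
move: f3 f1 f2; rewrite -!(ltr0z rat).
set F3 := facet m (3 * n1 + k) _ _; set F1 := facet m (3 * n2 + k) _ _.
set F2 := facet m (3 * n3 + k) _ _; move: F1 F2 F3 => F1 F2 F3 x3 x1 x2.
rewrite !intrD intrM.
have -> : ((9 * mz + 4) ^+ 3 - 1)%:~R = (9 * M + 4) ^+ 3 - 1 :> rat by ring.
have D0 : 0 < (9 * M + 4) ^+ 3 - 1.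
  have := ler0n rat m; move: M => M' M'0.
  have M2 : 0 <= M' ^+ 2 by rewrite exprn_ge0.
  have M3 : 0 <= M' ^+ 3 by rewrite exprn_ge0.
  by lra.
have [L1 E1] := unit_levK _ he.
have [L2 E2] := unit_levK _ (unitKM _ _ he unitK_e2K).
have [L3 E3] := unit_levK _ (unitKM _ _ he unitK_e3K).
move=> fs eq; have [Lk tight] := weighted_min _ _ _ _ _ _ _ _ _ _ _ D0 x1 x2 x3 L1 L2 L3 fs eq isT.
split=> // /tight [z1 z2 z3].
case: (E1 z1) => // ee.
(* e = rho^2 and e = e3 are excluded because their squares have level above 3. *)
- have : levK (mulK e e2K) = 54 + 216 * M + 243 * (M * M).
    by rewrite ee /levK /e2K; Kfield.
  by rewrite z2 => /(quadratic_neq3 _ 54 216 243 _ isT (ler0n _ _)).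
- have : levK (mulK e (e3K m)) = 81 + 270 * M + 243 * (M * M).
    by rewrite ee /levK /e3K; Kfield.
  by rewrite z3 => /(quadratic_neq3 _ 81 270 243 _ isT (ler0n _ _)).
Qed.

(** * Indecomposability, traces and non-associatedness of the listed elements *)

Lemma gel1_one : gel 1 0 0 = oneK. Proof. by rewrite (oneK_V m); exact: gel1_V. Qed.

Lemma minK_tr1 (c : Kel) : c \in list_tr1 n -> [/\ intK c, tpK c & minK c 1].
Proof.
have lev2 n2 n3 : -1 + n2 + n3 = 3 * mz * 2 -> 3 * mz <= n2 -> 0 <= n3 ->
    [/\ intK (V 2 (-1) n2 n3), tpK (V 2 (-1) n2 n3) & minK (V 2 (-1) n2 n3) 1].
  move=> h h2 h3; have p := tpV_lev2 _ _ h h2 h3.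
  split; [exact: intK_V | exact: p | apply: (minK_one_lower _ d1K) => //].
  - exact: intK_V.
  - exact: codK_d1K.
  - exact: tpK_d1K.
  - by rewrite traceK_d1K psiK_V.
have tau_step x : [/\ intK x, tpK x & minK x 1] ->
    [/\ intK (tauK x), tpK (tauK x) & minK (tauK x) 1].
  by case=> ix px mx; split; [exact: intK_tauK | exact: tpK_tauK | exact: minK_tauK].
rewrite /list_tr1 !mem_cat => /or4P [ | | | /orP[]].
- by move/mem_list_i ->; rewrite (g3K_V m); apply: lev2; lia.
- move/mem_list_v => [n1 [n2 [n3 [h h1 h2 h3 ->]]]].
  have p : tpK (V 1 n1 n2 n3) by apply: tpV_pos; lia.
  split; [exact: intK_V | exact: p | apply: (minK_one_lower _ d0K) => //].
  - exact: intK_V.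
  - exact: codK_d0K.
  - exact: tpK_d0K.
  - by rewrite traceK_d0K levK_V.
- by move/mem_list_vi => [n2 [n3 [h h2 h3 ->]]]; apply: lev2; lia.
- move/mem_list_vii => [n2 [n3 [h h2 h3 ->]]].
  have h' : n2 + n3 + -1 = 3 * mz * 2 by lia.
  rewrite -(tauK_V m _ _ _ _ h') -(tauK_V m _ _ _ _ h).
  by apply: (tau_step); apply: (tau_step); apply: lev2; lia.
- move/mem_list_viii => [n2 [n3 [h h2 h3 ->]]].
  by rewrite -(tauK_V m _ _ _ _ h); apply: (tau_step); apply: lev2; lia.
Qed.

Lemma minK_tr2 (c : Kel) : c \in list_tr2 n -> indK c /\ minK c 2.
Proof.
have tau_step x : indK x /\ minK x 2 -> indK (tauK x) /\ minK (tauK x) 2.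
  by case=> ix mx; split; [exact: indK_tauK | exact: minK_tauK].
have lev3 n2 n3 : -1 + n2 + n3 = 3 * mz * 3 -> -1 <= n2 <= 3 * mz - 1 ->
    indK (V 3 (-1) n2 n3) /\ minK (V 3 (-1) n2 n3) 2.
  by move=> h h2; split; [exact: indK_lev3 | exact: minK_lev3].
rewrite /list_tr2 !mem_cat => /or3P [].
- by move/mem_list_ii => [n2 [n3 [h h2 ->]]]; exact: lev3.
- move/mem_list_iii => [n2 [n3 [h h2 ->]]].
  have h' : n2 + n3 + -1 = 3 * mz * 3 by lia.
  rewrite -(tauK_V m _ _ _ _ h') -(tauK_V m _ _ _ _ h).
  by apply: (tau_step); apply: (tau_step); exact: lev3.
- move/mem_list_iv => [n2 [n3 [h h2 ->]]].
  by rewrite -(tauK_V m _ _ _ _ h); apply: (tau_step); exact: lev3.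
Qed.

Lemma indK_list (c : Kel) : c \in indec_list n -> indK c.
Proof.
rewrite /indec_list inE mem_cat => /or3P [/eqP -> | /minK_tr1 [ic pc mc] | /minK_tr2 []//].
  rewrite gel1_one; split; [exact: intK_one | exact: tpK_one |].
  exact: unit_not_decK unitK_one.
exact: minK_indK.
Qed.

Lemma interior_rot (k n1 n2 n3 : int) : interior k n1 n2 n3 -> interior k n2 n3 n1.
Proof. by case. Qed.

Lemma interior_lev1 (n1 n2 n3 : int) : 0 <= n1 -> 0 <= n2 -> 0 <= n3 ->
  interior 1 n1 n2 n3.
Proof. by move=> h1 h2 h3; split; rewrite /facet; nia. Qed.

Lemma interior_lev2 (n2 n3 : int) : 3 * mz + 1 <= n2 -> 0 <= n3 ->
  interior 2 (-1) n2 n3.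
Proof. by move=> h2 h3; split; rewrite /facet; nia. Qed.

Lemma interior_lev3 (n2 n3 : int) : -1 + n2 + n3 = 3 * mz * 3 ->
  -1 <= n2 <= 3 * mz - 1 -> interior 3 (-1) n2 n3.
Proof. by move=> h /andP[h2 h2']; split; rewrite /facet; nia. Qed.

Lemma list_interior (c : Kel) : c \in indec_list n -> c != oneK -> c != g3K ->
  exists k n1 n2 n3, [/\ n1 + n2 + n3 = 3 * mz * k, c = V k n1 n2 n3 &
    interior k n1 n2 n3].
Proof.
rewrite /indec_list /list_tr1 /list_tr2 inE !mem_cat gel1_one.
case/or3P => [-> // | /or4P [ | | | /orP[]] | /or3P []].
- by move/mem_list_i ->; rewrite eqxx.
- move/mem_list_v => [n1 [n2 [n3 [h h1 h2 h3 ->]]]] _ _.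
  by exists 1, n1, n2, n3; split=> //; exact: interior_lev1.
- move/mem_list_vi => [n2 [n3 [h h2 h3 ->]]] _ _.
  by exists 2, (-1), n2, n3; split=> //; exact: interior_lev2.
- move/mem_list_vii => [n2 [n3 [h h2 h3 ->]]] _ _.
  exists 2, n3, (-1), n2; split=> //; first by lia.
  by apply: interior_rot; apply: interior_rot; exact: interior_lev2.
- move/mem_list_viii => [n2 [n3 [h h2 h3 ->]]] _ _.
  exists 2, n2, n3, (-1); split=> //; first by lia.
  by apply: interior_rot; exact: interior_lev2.
- move/mem_list_ii => [n2 [n3 [h h2 ->]]] _ _.
  by exists 3, (-1), n2, n3; split=> //; exact: interior_lev3.
- move/mem_list_iii => [n2 [n3 [h h2 ->]]] _ _.
  exists 3, n3, (-1), n2; split=> //; first by lia.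
  by apply: interior_rot; apply: interior_rot; exact: interior_lev3.
- move/mem_list_iv => [n2 [n3 [h h2 ->]]] _ _.
  exists 3, n2, n3, (-1); split=> //; first by lia.
  by apply: interior_rot; exact: interior_lev3.
Qed.

Lemma levK_list_min (c e : Kel) : c \in indec_list n -> unitK e ->
  levK c <= levK (mulK e c) /\
  (c != oneK -> c != g3K -> levK (mulK e c) = levK c -> e = oneK).
Proof.
move=> hc he; have [-> | c1] := eqVneq c oneK.
  split; last by move=> /negP[].
  rewrite mulKC mul1K (oneK_V m) levK_V; have [h _] := unit_levK _ he.
  exact: h.
have [-> | c3] := eqVneq c g3K.
  split; last by move=> _ /negP[].
  have [ie _ _] := he.
  have i3 : intK g3K by rewrite (g3K_V m); exact: intK_V.
  have [k [n1 [n2 [n3 [_ hk]]]]] := intKP m _ (intKM _ _ ie i3).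
  (* 6 e g3 is a sum of three totally positive units, each of level at least 3. So k(e g3) >= 3/2,
     and integrality gives 2 = k(g3). *)
  have := congr1 (fun x => levK (mulK e x)) (g3K_cone m).
  rewrite /= !mulKDr mulK_scale !levKD levK_scale (mulKC _ e oneK) mul1K.
  have [L1 _] := unit_levK _ he.
  have [L2 _] := unit_levK _ (unitKM _ _ he unitK_e2K).
  have [L3 _] := unit_levK _ (unitKM _ _ he unitK_eps2).
  rewrite hk (g3K_V m) !levK_V => eq.
  have : 9 <= 6 * k%:~R :> rat by rewrite eq; lra.
  by rewrite -[9]/(9%:~R) -[6]/(6%:~R) -intrM !ler_int; lia.
have [k [n1 [n2 [n3 [h -> hi]]]]] := list_interior c hc c1 c3.
have [l1 l2] := levK_unit_mul _ _ _ _ _ h hi he.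
by rewrite levK_V; split.
Qed.

(** Both elements minimise k in the same class, so their levels agree. If either is interior to the
    cone, the unit is 1; the remaining candidates 1 and g3 have levels 3 and 2. *)
Lemma list_nonassoc (c c' e : Kel) : c \in indec_list n -> c' \in indec_list n ->
  unitK e -> c = mulK e c' -> c = c'.
Proof.
move=> hc hc' he ee; have [f hf ef] := unitK_inv _ he.
have ff : c' = mulK f c by rewrite ee mulKA (mulKC _ f) ef mul1K.
have [l1 t1] := levK_list_min _ _ hc' he; have [l2 t2] := levK_list_min _ _ hc hf.
rewrite -ee in l1 t1; rewrite -ff in l2 t2.
have l : levK c = levK c' by apply: le_anti; rewrite l1 l2.
have [c1 | c1] := eqVneq c oneK; last first.
  have [c3 | c3] := eqVneq c g3K; last by rewrite ff (t2 c1 c3 (esym l)) mul1K.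
  have [d1 | d1] := eqVneq c' oneK.
    by move: l; rewrite c3 d1 (g3K_V m) (oneK_V m) !levK_V => /intr_inj.
  have [d3 | d3] := eqVneq c' g3K; first by rewrite c3 d3.
  by rewrite ee (t1 d1 d3 l) mul1K.
have [d1 | d1] := eqVneq c' oneK; first by rewrite c1 d1.
have [d3 | d3] := eqVneq c' g3K.
  by move: l; rewrite c1 d3 (g3K_V m) (oneK_V m) !levK_V => /intr_inj.
by rewrite ee (t1 d1 d3 l) mul1K.
Qed.

Lemma g3K_mem : g3K \in indec_list n.
Proof.
rewrite /indec_list inE mem_cat /list_tr1 mem_cat.
by rewrite (introT (mem_list_i m _) erefl) orbT.
Qed.

(** The second alternative covers the vertices rho^2 and e3, which are represented in the list by
    1. *)
Lemma base_mem (k n1 n2 n3 : int) : n1 + n2 + n3 = 3 * mz * k ->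
  [\/ base k n1 n2 n3, base k n2 n3 n1 | base k n3 n1 n2] ->
  V k n1 n2 n3 \in indec_list n \/ unitK (V k n1 n2 n3).
Proof.
move=> h hb.
have [] : [\/ [\/ V k n1 n2 n3 = oneK, V k n1 n2 n3 = e2K | V k n1 n2 n3 = e3K m],
   V k n1 n2 n3 \in list_v n,
   [|| V k n1 n2 n3 \in list_vi n, V k n1 n2 n3 \in list_vii n |
       V k n1 n2 n3 \in list_viii n] |
   [|| V k n1 n2 n3 \in list_ii n, V k n1 n2 n3 \in list_iii n |
       V k n1 n2 n3 \in list_iv n]].
- case: hb => [] [[ek e1 e2 e3] | [ek [b1 b2 b3]] | [ek b1 b2 b3] | [ek b1 b2]]; subst k.
  + by apply: Or41; apply: Or31; rewrite e1 e2 e3 (oneK_V m).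
  + by apply: Or42; apply/mem_list_v; exists n1, n2, n3.
  + apply: Or43; apply/or3P; apply: Or31; apply/mem_list_vi; exists n2, n3.
    by rewrite b1 in h *; split.
  + apply: Or44; apply/or3P; apply: Or31; apply/mem_list_ii; exists n2, n3.
    by rewrite b1 in h *; split.
  + by apply: Or41; apply: Or32; rewrite e1 e2 e3 (e2K_V m).
  + by apply: Or42; apply/mem_list_v; exists n1, n2, n3.
  + apply: Or43; apply/or3P; apply: Or32; apply/mem_list_vii; exists n3, n1.
    by rewrite b1 in h *; split=> //; lia.
  + apply: Or44; apply/or3P; apply: Or32; apply/mem_list_iii; exists n3, n1.
    by rewrite b1 in h *; split=> //; lia.
  + by apply: Or41; apply: Or33; rewrite e1 e2 e3 e3K_V.
  + by apply: Or42; apply/mem_list_v; exists n1, n2, n3.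
  + apply: Or43; apply/or3P; apply: Or33; apply/mem_list_viii; exists n1, n2.
    by rewrite b1 in h *; split=> //; lia.
  + apply: Or44; apply/or3P; apply: Or33; apply/mem_list_iv; exists n1, n2.
    by rewrite b1 in h *; split=> //; lia.
- by case=> ->; right; [exact: unitK_one | exact: unitK_e2K | exact: unitK_e3K].
- by move=> hv; left; rewrite /indec_list inE !mem_cat hv !orbT.
- by case/or3P => hv; left; rewrite /indec_list inE !mem_cat hv !orbT.
- by case/or3P => hv; left; rewrite /indec_list inE !mem_cat hv !orbT.
Qed.

Lemma indK_assoc_list (x : Kel) : indK x ->
  exists e c, [/\ unitK e, c \in indec_list n & x = mulK e c].
Proof.
move=> /indK_listed [e [y [he [-> | [k [n1 [n2 [n3 [h -> hb]]]]]] ->]]].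
  by exists e, g3K; split=> //; exact: g3K_mem.
have [hm | hu] := base_mem _ _ _ _ h hb.
  by exists e, (V k n1 n2 n3); split.
exists (mulK e (V k n1 n2 n3)), oneK; split; first exact: unitKM.
  by rewrite -gel1_one mem_head.
by rewrite (mulKC _ _ oneK) mul1K.
Qed.

End Traces.

(** * Back to complex embeddings *)

Section Transfer.
Variable m : nat.
Local Notation n := (9 * m + 3)%N.
Local Notation a := (n%:R : rat).
Variables rho r2 r3 : algC.
Hypothesis hf : cubpoly n = ('X - rho%:P) * ('X - r2%:P) * ('X - r3%:P).
Hypothesis sqf : squarefree (3 * m ^ 2 + 3 * m + 1).
Hypothesis m3 : ~~ (3 %| 2 * m + 1)%N.

Lemma root_cases (s : algC) : isroot a s <-> [\/ s = rho, s = r2 | s = r3].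
Proof.
rewrite -root_cubR (_ : cubR n algC = cubpoly n) // hf !rootM !root_XsubC.
split; first by case/orP=> [/orP[]|] /eqP ->; [exact: Or31 | exact: Or32 | exact: Or33].
by case=> ->; rewrite eqxx ?orbT.
Qed.

Let hr : isroot a rho. Proof. by apply/root_cases; exact: Or31. Qed.

(** A fixed point of r |-> -1 - 1/r satisfies 1 + r + r^2 = 0, which a root of degree 3 cannot. *)
Lemma conjr_neq (s : algC) : isroot a s -> conjr s <> s.
Proof.
move=> hs e; have s0 := isroot_neq0 _ _ hs.
have : emb s (1, 1, 1) = 0.
  rewrite /emb /= rmorph1 !mul1r; have -> : 1 + s + s ^+ 2 = s * (s - conjr s).
    by rewrite /conjr; field.
  by rewrite e subrr mulr0.
by move/(emb_eq0 _ _ _ hs) => [/eqP]; rewrite oner_eq0.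
Qed.

(** The factorisation does not fix the order of [r2] and [r3]; the trace is symmetric in them. *)
Lemma other_roots : (r2 = conjr rho /\ r3 = conjr (conjr rho)) \/
  (r3 = conjr rho /\ r2 = conjr (conjr rho)).
Proof.
have h1 := isroot_conjr _ _ hr; have h2 := isroot_conjr _ _ h1.
have n1 := conjr_neq _ hr; have n2 := conjr_neq _ h1; have n3 := conjr_neq _ h2.
rewrite (conjr3 _ _ hr) in n3.
case/root_cases: (h1) => [// | e1 | e1]; case/root_cases: (h2) => e2.
- by case: n3.
- by case: n2; rewrite e2.
- by left.
- by case: n3.
- by right.
- by case: n2; rewrite e2.
Qed.

Lemma totposP (c : Kel) : totpos rho r2 r3 c <-> tpK a c.
Proof.
split=> [[h1 [h2 h3]] s /root_cases[] -> // | h].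
by split; [|split]; apply: h; apply/root_cases; [exact: Or31 | exact: Or32 | exact: Or33].
Qed.

Lemma inOKP (c : Kel) : inOK rho c <-> intK c.
Proof. by split; [exact: inOK_intK hr sqf m3 _ | exact: intK_inOK hr _]. Qed.

Lemma trmulE (d c : Kel) : trmul rho r2 r3 d c = ratr (traceK a (mulK a d c)).
Proof.
have h1 := isroot_conjr _ _ hr; have h2 := isroot_conjr _ _ h1.
rewrite /trmul (emb_traceK _ _ _ hr) !(emb_mul a) //.
by case: other_roots => [[-> ->] // | [-> ->]]; rewrite addrAC.
Qed.

Lemma codiffP (d : Kel) : codiff rho r2 r3 d <-> codK m d.
Proof.
split=> h c hc.
  have /intrP [z hz] := h c ((inOKP c).2 hc); exists z.
  apply: (fmorph_inj (ratr : {rmorphism rat -> algC})).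
  by rewrite /= -trmulE hz ratr_int.
have [z hz] := h c ((inOKP c).1 hc).
by rewrite trmulE hz ratr_int intr_int.
Qed.

Lemma tpunitP (e : Kel) : tpunit rho r2 r3 e <-> unitK m e.
Proof.
split.
  case=> [[/inOKP ie [f [/inOKP jf ef]]] /totposP pe]; split=> //; exists f => //.
  by apply: (emb_inj _ _ _ _ hr); rewrite emb_mul // ef emb_one.
case=> ie pe [f jf ef]; split; last exact/totposP.
split; first exact/inOKP; exists f; split; first exact/inOKP.
by rewrite -(emb_mul a) // ef emb_one.
Qed.

Lemma indecomposableP (c : Kel) : indecomposable rho r2 r3 c <-> indK m c.
Proof.
split.
  case=> [/inOKP ic [/totposP pc nd]]; split=> // -[y [z [[iy py] [iz pz] e]]].
  apply: nd; exists y, z; rewrite e emb_add.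
  split; first exact/inOKP; split; first exact/totposP.
  by split; first exact/inOKP; split; first exact/totposP.
case=> ic pc nd; split; first exact/inOKP; split; first exact/totposP.
case=> y [z [/inOKP iy [/totposP py [/inOKP iz [/totposP pz e]]]]].
apply: nd; exists y, z; split=> //.
by apply: (emb_inj _ _ _ _ hr); rewrite emb_add.
Qed.

Lemma min_trace_isP (c : Kel) (t : nat) : minK m c t%:R -> min_trace_is rho r2 r3 c t.
Proof.
case=> [[d [cd pd dc]] hmin]; split.
  exists d; split; first exact/codiffP; split; first exact/totposP.
  by rewrite trmulE dc ratr_nat.
move=> d' /codiffP cd' /totposP pd'.
by rewrite trmulE -(ratr_nat algC) ler_rat; exact: hmin.
Qed.

Lemma tp_assocP (c c' : Kel) : tp_assoc rho r2 r3 c c' <->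
  exists2 e, unitK m e & c = mulK a e c'.
Proof.
split=> [[e [/tpunitP he ee]] | [e he ->]].
  by exists e => //; apply: (emb_inj _ _ _ _ hr); rewrite emb_mul.
by exists e; split; [exact/tpunitP | rewrite (emb_mul a)].
Qed.
End Transfer.

Theorem theorem1p2 (a : nat) (rho r2 r3 : algC) :
  (12 < a)%N ->
  (a %% 27 = 3 \/ a %% 27 = 21)%N ->
  squarefree ((a ^ 2 + 3 * a + 9) %/ 27) ->
  cubpoly a = ('X - rho%:P) * ('X - r2%:P) * ('X - r3%:P) ->
  [/\ (* the listed elements are indecomposable *)
      forall c, c \in indec_list a -> indecomposable rho r2 r3 c,
      (* every indecomposable is a totally positive unit times a listed one *)
      forall c, indecomposable rho r2 r3 c ->
        exists2 c', c' \in indec_list a & tp_assoc rho r2 r3 c c',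
      (* the listed elements are pairwise non-associated *)
      uniq (indec_list a) /\
        (forall c c', c \in indec_list a -> c' \in indec_list a ->
           tp_assoc rho r2 r3 c c' -> c = c'),
      (* minimal traces *)
      (forall c, c \in list_tr2 a -> min_trace_is rho r2 r3 c 2) /\
      (forall c, c \in list_tr1 a -> min_trace_is rho r2 r3 c 1)
    & (* the count *)
      (size (indec_list a))%:R = ((a ^ 2 + 3 * a)%:R / 18 + 2 * a%:R + 2 : rat)].
Proof.
move=> a12 a27 sqf hf.
pose m := (a %/ 9)%N.
have am : a = (9 * m + 3)%N by rewrite /m; lia.
have m2 : (1 < m)%N by lia.
(* Among the classes congruent to 3 mod 9, the missing class 12 mod 27 is the one with 3 | 2m +
   1. *)
have m3 : ~~ (3 %| 2 * m + 1)%N by lia.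
clearbody m; subst a.
have sqf' : squarefree (3 * m ^ 2 + 3 * m + 1).
  move: sqf; congr squarefree.
  have -> : ((9 * m + 3) ^ 2 + 3 * (9 * m + 3) + 9 = 27 * (3 * m ^ 2 + 3 * m + 1))%N by lia.
  by rewrite mulKn.
have hr : isroot (9 * m + 3)%:R rho by apply/(root_cases _ _ _ _ hf); exact: Or31.
have indP := indecomposableP _ _ _ _ hf sqf' m3.
have assocP := tp_assocP _ _ _ _ hf sqf' m3.
split.
- by move=> c hc; apply/indP; exact: (indK_list m rho).
- move=> c /indP hc.
  have [e [c' [he hc' ee]]] := indK_assoc_list m rho hr sqf' m3 m2 c hc.
  by exists c' => //; apply/assocP; exists e.
- split; first by apply: uniq_indec_list; lia.
  by move=> c c' hc hc' /assocP [e he ee]; exact: (list_nonassoc m rho hr sqf' m3 m2 _ _ e).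
- split=> c hc; apply: (min_trace_isP _ _ _ _ hf sqf' m3).
    by have [] := minK_tr2 m rho hr sqf' m3 m2 c hc.
  by have [] := minK_tr1 m rho hr sqf' m3 m2 c hc.
exact: size_indec_list.
Qed.
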